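(* Let $M_W,L_W\ge0$, $\rho\ge\rho_\Pi>0$, $\delta\in(0,1]$. Assume that $W$ is $(M_W,L_W)$-decomposable; that $m_*$ satisfies a $\rho$-Talagrand inequality; that $\Pi[\nu]$ satisfies a $\rho_\Pi$-log-Sobolev inequality for every $\nu\in\mathcal P_2(\mathcal X)$; and that for all $\nu\in\mathcal P_2(\mathcal X)$, $\mathcal F(\nu|m_* )\ge\delta H(\nu|m_* )$ and $H(\nu|\Pi[\nu])\ge\delta\mathcal F(\nu|m_* )$. Put $\ell_W=L_W/\rho$ and let $N$ be an integer with $N>\delta^{-1}(1+M_W+\ell_W)+1$. Then for all $\xi^1,\dots,\xi^N\in\mathcal P_2(\mathcal X)$, with $\bar\xi^{-i}=\frac1{N-1}\sum_{j\in[N],\,j\ne i}\xi^j$, $$\sum_{i\in[N]}I(\xi^i|\Pi[\bar\xi^{-i}])\ge2\lambda_N\,\mathcal F^N_{\mathrm{ind}}(\xi^1,\dots,\xi^N|m_* ),\qquad \frac{\lambda_N}{\rho_\Pi}=\delta-\frac{2(1+M_W+\ell_W)}{(N-1)\delta-1-M_W-\ell_W}.$$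
   Context: $\mathcal X$ is either $\mathbb T^d$ (flat torus) or $\mathbb R^d$; $\mathcal P_2$ denotes probability measures with finite second moment (all probability measures on the torus). $\langle\cdot,\cdot\rangle$ is integration of a function against a (signed) measure; $[N]=\{1,\dots,N\}$. A kernel $U:\mathcal X\times\mathcal X\to\mathbb R$ is of quadratic growth if $|U(x,y)|\le C(1+|x|^2+|y|^2)$ (void on the torus). Setting: $V:\mathcal X\to\mathbb R$ and $W:\mathcal X\times\mathcal X\to\mathbb R$ are of class $C^2$, $W$ symmetric of quadratic growth. For $\nu\in\mathcal P_2(\mathcal X)$, $\Pi[\nu](dx)\propto\exp(-V(x)-\langle W(x,\cdot),\nu\rangle)\,dx$ (assumed normalizable), and $m_*\in\mathcal P_2(\mathcal X)$ is a fixed measure with $m_*=\Pi[m_*]$. $H(\nu|m)=\int\log\frac{d\nu}{dm}\,d\nu$ ($+\infty$ if $\nu\not\ll m$); $I(\nu|m)=\int|\nabla\log\frac{d\nu}{dm}|^2\,d\nu$ ($+\infty$ if not well defined). Reduced kernel: $W_*(x,y)=W(x,y)-\langle W(x,\cdot),m_*\rangle-\langle W(\cdot,y),m_*\rangle+\langle W,m_*^{\otimes2}\rangle$. Functionals: $\mathcal F(\nu|m_* )=H(\nu|m_* )+\frac12\langle W_*,\nu^{\otimes2}\rangle$ and $\mathcal F^N_{\mathrm{ind}}(\xi^1,\dots,\xi^N|m_* )=\sum_{i\in[N]}H(\xi^i|m_* )+\frac1{2(N-1)}\sum_{i,j\in[N],\,i\ne j}\langle W_*,\xi^i\otimes\xi^j\rangle.$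 A kernel $U$ of quadratic growth is positive if $\langle U,(\nu-\nu')^{\otimes2}\rangle\ge0$ for all $\nu,\nu'\in\mathcal P_2(\mathcal X)$. $\mathrm{Osc}_2U=\sup_{x,y,z,w}\langle U,(\delta_x-\delta_y)\otimes(\delta_z-\delta_w)\rangle$. $W$ is $(M_W,L_W)$-decomposable if $W=W^+-W^-$ with $W^\pm$ positive symmetric kernels of quadratic growth such that: if $\mathcal X=\mathbb T^d$, $\mathrm{Osc}_2W^++\mathrm{Osc}_2W^-\le4M_W$ and $L_W=0$; if $\mathcal X=\mathbb R^d$, $W^s=W^s_{b}+W^s_{q}$ for $s=+,-$ with symmetric kernels satisfying $\mathrm{Osc}_2W_b^++\mathrm{Osc}_2W_b^-\le4M_W$ and $\|\nabla^2_{1,2}W_q^+\|_{L^\infty}+\|\nabla^2_{1,2}W_q^-\|_{L^\infty}\le L_W$ ($\nabla_{1,2}^2$ is the mixed second derivative matrix, in operator norm). $m$ satisfies a $\rho$-Talagrand inequality if $H(\nu|m)\ge\frac\rho2\mathcal W_2^2(\nu,m)$ for all $\nu\in\mathcal P_2(\mathcal X)$ ($\mathcal W_2$ the quadratic Wasserstein distance), and a $\kappa$-log-Sobolev inequality if $I(\nu|m)\ge2\kappa H(\nu|m)$ for all $\nu\in\mathcal P_2(\mathcal X)$. *)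

(* Defs.v *)
From HB Require Import structures.
From mathcomp Require Import all_boot all_order all_algebra.
From mathcomp Require Import all_classical all_reals all_analysis.
From mathcomp Require Import measurable_realfun.

Set Implicit Arguments.
Unset Strict Implicit.
Unset Printing Implicit Defensive.

Import Order.TTheory GRing.Theory Num.Theory.
Import numFieldNormedType.Exports.

Local Open Scope classical_set_scope.
Local Open Scope ring_scope.

(* The ambient space X is the flat torus T^d = R^d / Z^d or R^d.  Its points
   are row vectors: the torus is represented by the cell [0, 1[^d, functions on
   the torus are Z^d-periodic functions on R^d, and measures on the torus are
   measures on R^d carried by the cell. *)
Inductive ambient := Torus | Euclid.

Definition rv_display : measure_display.
Proof. exact: default_measure_display. Qed.

Section MeasurableRV.
Context (R : realType) (n : nat).

Definition rv_coord (i : 'I_n) (x : 'rV[R]_n) : measurableTypeR R := x 0 i.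

Let rv0 : g_sigma_preimage rv_coord set0.
Proof. exact: sigma_algebra0. Qed.

Let rvC A : g_sigma_preimage rv_coord A -> g_sigma_preimage rv_coord (~` A).
Proof. exact: sigma_algebraC. Qed.

Let rvU (F : (set 'rV[R]_n)^nat) :
  (forall i, g_sigma_preimage rv_coord (F i)) ->
  g_sigma_preimage rv_coord (\bigcup_i (F i)).
Proof. exact: sigma_algebra_bigcup. Qed.

(* The Borel sigma-algebra of R^n, generated by the coordinates. *)
HB.instance Definition _ := @isMeasurable.Build rv_display 'rV[R]_n
  (g_sigma_preimage rv_coord) rv0 rvC rvU.

Lemma measurable_rv_coord i : measurable_fun [set: 'rV[R]_n] (rv_coord i).
Proof.
move=> _ Y mY; rewrite setTI; apply: sub_sigma_algebra => /=.
rewrite -bigcup_seq/=; exists i => /=; first by rewrite mem_index_enum.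
by exists Y => //; rewrite setTI.
Qed.

Lemma measurable_fun_rv d (T : measurableType d) (f : T -> 'rV[R]_n) :
  (forall i, measurable_fun [set: T] (rv_coord i \o f)) ->
  measurable_fun [set: T] f.
Proof.
move=> mf; suff: g_sigma_preimage (fun i => rv_coord i \o f) `<=` measurable.
  rewrite g_sigma_preimage_comp => prefS _ A mA.
  by apply: prefS; exists A.
apply: smallest_sub; first exact: sigma_algebra_measurable.
rewrite -bigcup_seq; apply: bigcup_sub => i _.
by move=> A [B mB <-]; exact: mf.
Qed.

End MeasurableRV.

Section Lebesgue.
Context (R : realType).

Definition rv_snoc n (p : 'rV[R]_n * measurableTypeR R) : 'rV[R]_n.+1 :=
  \row_j (if unlift ord_max j is Some i then p.1 0 i else p.2).

Lemma measurable_rv_snoc n :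
  measurable_fun [set: 'rV[R]_n * measurableTypeR R] (@rv_snoc n).
Proof.
apply: measurable_fun_rv => j.
rewrite (_ : _ \o _ = fun p : 'rV[R]_n * measurableTypeR R =>
  if unlift ord_max j is Some i then rv_coord i p.1 else p.2); last first.
  by apply/funext => p; rewrite /rv_coord/= mxE.
case: (unlift _ _) => [i|]; last exact: measurable_snd.
by apply: measurableT_comp; [exact: measurable_rv_coord|exact: measurable_fst].
Qed.

Section lebesgue_step.
Context n (mu : {measure set 'rV[R]_n -> \bar R}).

Definition leb_step : set 'rV[R]_n.+1 -> \bar R :=
  pushforward (mu \x @lebesgue_measure R)%E (@rv_snoc n).

Let mpre A : measurable A -> measurable (@rv_snoc n @^-1` A).
Proof.
by move=> mA; rewrite -[X in measurable X]setTI; exact: measurable_rv_snoc.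
Qed.

Let leb_step0 : leb_step set0 = 0%E.
Proof. by rewrite /leb_step /pushforward preimage_set0 measure0. Qed.

Let leb_step_ge0 A : (0 <= leb_step A)%E.
Proof. exact: (measure_ge0 (mu \x @lebesgue_measure R)%E). Qed.

Let leb_step_sigma_additive : semi_sigma_additive leb_step.
Proof.
move=> F mF tF mUF; rewrite /leb_step /pushforward preimage_bigcup.
apply: measure_semi_sigma_additive.
- by move=> k; exact: mpre.
- apply/trivIsetP => /= i j _ _ ij; rewrite -preimage_setI.
  by move/trivIsetP : tF => /(_ _ _ _ _ ij) ->//; rewrite preimage_set0.
- by rewrite -preimage_bigcup; exact: mpre.
Qed.

HB.instance Definition _ := isMeasure.Build _ _ _ leb_step
  leb_step0 leb_step_ge0 leb_step_sigma_additive.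

End lebesgue_step.

(* Lebesgue measure on R^n. *)
Fixpoint leb n : {measure set 'rV[R]_n -> \bar R} :=
  if n is n'.+1 then leb_step (leb n') else \d_(0 : 'rV[R]_0).

End Lebesgue.

Section Space.
Context (R : realType) (d : nat).
Local Notation X := 'rV[R]_d.
Implicit Types (S : ambient) (x y : X).

Definition carrier S : set X :=
  if S is Torus then [set x | forall i, 0 <= x 0 i < 1] else setT.

Lemma measurable_carrier S : measurable (carrier S).
Proof.
case: S; last exact: measurableT.
rewrite (_ : carrier _ = \bigcap_(i in [set: 'I_d]) (rv_coord i @^-1` `[0, 1[)).
  apply: fin_bigcap_measurable => // i _; rewrite -[X in measurable X]setTI.
  by apply: measurable_rv_coord => //; exact: measurable_itv.
apply/seteqP; split=> x /= hx i => [_|]; first by rewrite /= in_itv/= hx.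
by have := hx i I; rewrite /= in_itv.
Qed.

(* f is the lift to R^d of a function on X. *)
Definition lifted (T : Type) S (f : X -> T) : Prop :=
  if S is Torus then
    forall x (k : 'rV[int]_d), f (x + map_mx intr k) = f x
  else True.

(* The library norm on 'rV is the sup norm, hence this definition. *)
Definition enorm x : R := Num.sqrt (\sum_i x 0 i ^+ 2).

Definition space_dist S x y : R :=
  if S is Torus then
    inf [set enorm (x - y + map_mx intr k) | k in [set: 'rV[int]_d]]
  else enorm (x - y).

Definition P2 S (nu : probability X R) : Prop :=
  if S is Torus then nu (carrier Torus) = 1%E
  else (\int[nu]_x (enorm x ^+ 2)%:E < +oo)%E.

End Space.

Section Smoothness.
Context (R : realType).

(* All iterated directional derivatives up to order k exist and are
   continuous; in finite dimension this is the class C^k. *)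
Fixpoint Ck (E : normedModType R) (k : nat) (f : E -> R^o) : Prop :=
  continuous f /\
  if k is k'.+1 then
    forall v : E, (forall x, derivable f x v) /\ Ck k' ('D_v f)
  else True.

Definition grad d (f : 'rV[R]_d -> R^o) (x : 'rV[R]_d) : 'rV[R]_d :=
  \row_i 'D_(delta_mx 0 i) f x.

End Smoothness.

Section Kernels.
Context (R : realType) (d : nat).
Local Notation X := 'rV[R]_d.
Implicit Types (S : ambient) (U : X * X -> R) (m nu : probability X R).

Definition is_kernel S U : Prop :=
  [/\ measurable_fun [set: X * X] U,
      forall x, lifted S (fun y => U (x, y)) &
      forall y, lifted S (fun x => U (x, y))].

(* On the torus this says that U is bounded, which is automatic if U is
   continuous and is otherwise needed to integrate U. *)
Definition quadratic_growth S U : Prop :=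
  exists C : R, forall x y, carrier S x -> carrier S y ->
    `|U (x, y)| <= C * (1 + enorm x ^+ 2 + enorm y ^+ 2).

Definition symmetric_kernel U : Prop := forall x y, U (x, y) = U (y, x).

Definition bracket U m nu : R := \int[(m \x nu)%E]_p U p.

(* < U, (nu - nu')^{\otimes 2} >, expanded by bilinearity. *)
Definition bracket_diff U nu nu' : R :=
  bracket U nu nu - bracket U nu nu' - bracket U nu' nu + bracket U nu' nu'.

Definition positive_kernel S U : Prop :=
  forall nu nu', P2 S nu -> P2 S nu' -> 0 <= bracket_diff U nu nu'.

Definition Osc2 U : \bar R :=
  ereal_sup [set t | exists x y z w : X,
    t = (U (x, z) - U (x, w) - U (y, z) + U (y, w))%:E].

Definition grad2 U (x y : X) : X := grad (fun y' => U (x, y')) y.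

(* The matrix with entries d_{x_i} d_{y_j} U (x, y). *)
Definition hess12 U (x y : X) : 'M[R]_d :=
  \matrix_(i, j) 'D_(delta_mx 0 i) (fun x' => grad2 U x' y 0 j : R^o) x.

Definition has_hess12 U : Prop := forall x y : X,
  differentiable (fun y' => U (x, y') : R^o) y /\
  differentiable (fun x' => grad2 U x' y) x.

Definition opnorm (A : 'M[R]_d) : \bar R :=
  ereal_sup [set (enorm (v *m A))%:E | v in [set v : X | enorm v <= 1]].

(* The mixed derivative is defined pointwise, and its L^oo norm is the supremum
   of its operator norm (the same as the essential supremum when the derivative
   is continuous). *)
Definition norm_hess12 U : \bar R :=
  ereal_sup [set opnorm (hess12 U p.1 p.2) | p in [set: X * X]].

Definition decomposable S (MW LW : R) (W : X * X -> R) : Prop :=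
  exists Wp Wm : X * X -> R,
    [/\ forall p, W p = Wp p - Wm p,
        [/\ is_kernel S Wp, quadratic_growth S Wp,
            symmetric_kernel Wp & positive_kernel S Wp],
        [/\ is_kernel S Wm, quadratic_growth S Wm,
            symmetric_kernel Wm & positive_kernel S Wm] &
        match S with
        | Torus => (Osc2 Wp + Osc2 Wm <= (4 * MW)%:E)%E /\ LW = 0
        | Euclid => exists Wpb Wpq Wmb Wmq : X * X -> R,
          [/\ forall p, Wp p = Wpb p + Wpq p,
              forall p, Wm p = Wmb p + Wmq p,
              [/\ is_kernel S Wpb, is_kernel S Wpq,
                  is_kernel S Wmb & is_kernel S Wmq],
              [/\ symmetric_kernel Wpb, symmetric_kernel Wpq,
                  symmetric_kernel Wmb & symmetric_kernel Wmq] &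
              [/\ (Osc2 Wpb + Osc2 Wmb <= (4 * MW)%:E)%E,
                  has_hess12 Wpq, has_hess12 Wmq &
                  (norm_hess12 Wpq + norm_hess12 Wmq <= LW%:E)%E]]
        end].

Definition reduced (W : X * X -> R) m (p : X * X) : R :=
  W p - \int[m]_y W (p.1, y) - \int[m]_x W (x, p.2) + bracket W m m.

End Kernels.

Section Gibbs.
Context (R : realType) (d : nat).
Local Notation X := 'rV[R]_d.

Section gibbs_def.
Context (S : ambient) (f : X -> R).

(* The measure exp(-f) dx on X.  The test on measurability is always passed by
   the potentials below; it makes the definition total. *)
Definition gibbs_measure (A : set X) : \bar R :=
  if `[< measurable_fun [set: X] f >] then
    (\int[leb R d]_(x in carrier S `&` A) (expR (- f x))%:E)%E
  else 0%E.

Let gibbs0 : gibbs_measure set0 = 0%E.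
Proof. by rewrite /gibbs_measure setI0 integral_set0 if_same. Qed.

Let gibbs_ge0 A : (0 <= gibbs_measure A)%E.
Proof.
rewrite /gibbs_measure; case: ifP => // _.
by apply: integral_ge0 => x _; rewrite lee_fin expR_ge0.
Qed.

Let gibbs_sigma_additive : semi_sigma_additive gibbs_measure.
Proof.
rewrite /gibbs_measure; case: asboolP => [mf|_] F mF tF mUF; last first.
  by rewrite (_ : (fun=> _) = cst 0%E);
    [exact: cvg_cst|apply/funext => n; rewrite big1].
have fpos x : (0 <= (expR (- f x))%:E)%E by rewrite lee_fin expR_ge0.
rewrite setI_bigcupr ge0_integral_bigcup//=.
- apply: is_cvg_ereal_nneg_natsum_cond => n _ _.
  by apply: integral_ge0 => x _; exact: fpos.
- by move=> k; apply: measurableI => //; exact: measurable_carrier.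
- apply: (@measurable_funS _ _ _ _ setT) => //.
  by apply/measurable_EFinP; do 2 apply: measurableT_comp => //.
- exact: trivIset_setIl.
Qed.

HB.instance Definition _ := isMeasure.Build _ _ _ gibbs_measure
  gibbs0 gibbs_ge0 gibbs_sigma_additive.

End gibbs_def.

Definition gibbs_potential (V : X -> R) (W : X * X -> R)
    (nu : {measure set X -> \bar R}) (x : X) : R :=
  V x + \int[nu]_y W (x, y).

(* The Dirac mass at 0 is a default value, returned only if the total mass is 0
   or +oo, which [normalizable] excludes. *)
Definition Pi_map S V W (nu : {measure set X -> \bar R}) : probability X R :=
  mnormalize (gibbs_measure S (gibbs_potential V W nu)) (\d_(0 : X)).

Definition normalizable S V W : Prop :=
  forall nu : probability X R, P2 S nu ->
    (0 < \int[leb R d]_(x in carrier S) (expR (- gibbs_potential V W nu x))%:E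
       < +oo)%E.

End Gibbs.

Section Mean.
Context (R : realType) (d N : nat).
Local Notation X := 'rV[R]_d.
Context (xi : 'I_N -> probability X R) (i : 'I_N).

(* The average of the N - 1 measures xi^j, j != i. *)
Definition others_mean (A : set X) : \bar R :=
  ((N%:R - 1)^-1%:E * \sum_(j < N | j != i) xi j A)%E.

Let c_ge0 : 0 <= (N%:R - 1)^-1 :> R.
Proof.
by rewrite invr_ge0 subr_ge0 ler1n (leq_ltn_trans _ (ltn_ord i)).
Qed.

Let mean0 : others_mean set0 = 0%E.
Proof. by rewrite /others_mean big1 ?mule0// => j _; rewrite measure0. Qed.

Let mean_ge0 A : (0 <= others_mean A)%E.
Proof. by apply: mule_ge0; [rewrite lee_fin|apply: sume_ge0]. Qed.

Let mean_sigma_additive : semi_sigma_additive others_mean.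
Proof.
move=> F mF tF mUF; rewrite /others_mean.
rewrite (_ : (fun n => _) = (fun n => (N%:R - 1)^-1%:E *
  \sum_(j < N | j != i) \sum_(0 <= k < n) xi j (F k))%E); last first.
  apply/funext => n; rewrite -ge0_sume_distrr; last first.
    by move=> k _; apply: sume_ge0.
  by rewrite exchange_big.
apply: cvgeZl => //.
apply: cvg_nnesum => //.
- by move=> j _; apply: nearW => n; exact: sume_ge0.
- by move=> j _; exact: measure_semi_sigma_additive.
Qed.

HB.instance Definition _ := isMeasure.Build _ _ _ others_mean
  mean0 mean_ge0 mean_sigma_additive.

End Mean.

Section Functionals.
Context (R : realType) (d : nat).
Local Notation X := 'rV[R]_d.
Implicit Types (S : ambient) (W : X * X -> R) (m nu : probability X R).

Definition rn_density nu m (x : X) : R :=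
  fine (Radon_Nikodym (charge_of_finite_measure nu) m x).

Definition rel_entropy nu m : \bar R :=
  if `[< nu `<< m >] then (\int[nu]_x (ln (rn_density nu m x))%:E)%E else +oo%E.

Definition test_function S (phi : X -> R) : Prop :=
  (forall k, Ck k phi) /\
  if S is Torus then lifted S phi
  else exists r : R, forall x, r < enorm x -> phi x = 0.

Definition loc_integrable S (f : X -> R) : Prop :=
  forall r : R, (leb R d).-integrable (carrier S `&` [set x | enorm x <= r])
                  (EFin \o f).

(* g is the weak gradient of h on X. *)
Definition weak_grad S (h : X -> R) (g : X -> X) : Prop :=
  [/\ loc_integrable S h, forall i, loc_integrable S (fun x => g x 0 i) &
      forall phi, test_function S phi -> forall i : 'I_d,
        \int[leb R d]_(x in carrier S) (h x * grad phi x 0 i) =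
        - \int[leb R d]_(x in carrier S) (g x 0 i * phi x)].

(* With h = d nu / d m, grad (log h) is read as (grad h) / h, where grad h is
   the weak gradient; h > 0 almost everywhere for nu.  For m equivalent to dx
   on X, as is Pi[nu], weak gradients are unique almost everywhere and the set
   below has at most one element; it is empty, with infimum +oo, if h has no
   weak gradient. *)
Definition Fisher S nu m : \bar R :=
  if `[< nu `<< m >] then
    ereal_inf [set (\int[nu]_x (enorm ((rn_density nu m x)^-1 *: g x) ^+ 2)%:E)%E
              | g in [set g | weak_grad S (rn_density nu m) g]]
  else +oo%E.

Definition is_coupling nu m (pi : probability (X * X)%type R) : Prop :=
  forall A, measurable A ->
    pi (A `*` setT) = nu A /\ pi (setT `*` A) = m A.

(* The square of the quadratic Wasserstein distance. *)
Definition W2sq S nu m : \bar R :=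
  ereal_inf [set (\int[pi]_p (space_dist S p.1 p.2 ^+ 2)%:E)%E
            | pi in [set pi | is_coupling nu m pi]].

Definition Talagrand S (rho : R) m : Prop :=
  forall nu, P2 S nu -> ((rho / 2)%:E * W2sq S nu m <= rel_entropy nu m)%E.

Definition log_Sobolev S (kappa : R) m : Prop :=
  forall nu, P2 S nu -> ((2 * kappa)%:E * rel_entropy nu m <= Fisher S nu m)%E.

Definition free_energy W m nu : \bar R :=
  (rel_entropy nu m + (1 / 2 * bracket (reduced W m) nu nu)%:E)%E.

Definition free_energy_ind N W m (xi : 'I_N -> probability X R) : \bar R :=
  (\sum_(i < N) rel_entropy (xi i) m +
   ((2 * (N%:R - 1))^-1 *
    \sum_(i < N) \sum_(j < N | i != j)
      bracket (reduced W m) (xi i) (xi j))%:E)%E.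

End Functionals.

(* Main.v *)
Require Import Defs.
From HB Require Import structures.
From mathcomp Require Import all_boot all_order all_algebra.
From mathcomp Require Import all_classical all_reals all_analysis.
From mathcomp Require Import measurable_realfun ring lra.

(* Write m for m_star, W_m for the reduced kernel, b(mu, nu) for
   <W_m, mu (x) nu>, n = N - 1 and nu_i for the mean of the xi^j, j != i.  The
   relative entropy with respect to Pi[nu_i] is
     H(xi | Pi[nu_i]) = H(xi | m) + b(xi, nu_i) + (constant in xi).
   The constant is bounded below by applying H(. | Pi[nu_i]) >= delta F to nu_i
   itself, and convexity of the entropy bounds H(nu_i | m) by the mean of the
   H(xi^j | m).  Summing over i gives
     sum_i H(xi^i | Pi[nu_i]) >= delta F_ind
       + (1 - delta / 2) / n * (1/n sum_{i != j} b(xi^i, xi^j) - sum_i b(xi^i, xi^i)).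
   Positivity of W^+ and W^- bounds the last bracket below by
   - (N / n) sum_i b^+(xi^i, xi^i), and Pinsker's inequality (for W_b^+) and
   Talagrand's inequality (for W_q^+) give
   b^+(xi, xi) <= 2 (M_W + L_W / rho) H(xi | m).  Finally F >= delta H at the
   mean of all the xi^i bounds sum_i H(xi^i | m) by a multiple of F_ind, and the
   log-Sobolev inequalities for the Pi[nu_i] conclude. *)

Set Implicit Arguments.
Unset Strict Implicit.
Unset Printing Implicit Defensive.

Import Order.TTheory GRing.Theory Num.Theory.
Import numFieldNormedType.Exports.
Import HBNNSimple.

Local Open Scope classical_set_scope.
Local Open Scope ring_scope.

(** * Relative entropy and Pinsker's inequality *)

(** [F_ind] leaves out the diagonal i = j, while F at a mean of the xi^i contains it: this mismatch
    is the source of the error term. Centring makes b(mu, mu) equal to <W, (mu - m) (x) (mu - m)>,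
    so a diagonal term measures how far mu is from m and can be paid for with H(mu | m). Only the
    W^+ part has to be paid for: the diagonal of W^- has the good sign and, by positivity on pairs,
    also absorbs the off-diagonal terms of W^-. In the constant, put k = M_W + L_W / rho. At the
    mean of all the xi^i, F >= delta H costs (1 - delta) N sum_i H(xi^i | m), and removing the
    diagonal from F_ind costs k sum_i H(xi^i | m); what remains is n F_ind >= (n delta - 1 - k)
    sum_i H(xi^i | m), hence the denominator. The error has numerator (2 - delta) (k + k / n), and 2
    (1 + k) is an upper bound for it because k <= n. Entropies may be infinite, so the identities
    between them are proved in the extended reals with nonnegative integrands, and the infinite case
    is settled before any real arithmetic. *)

Section Density.
Context d (T : measurableType d) (R : realType).
Implicit Types (mu nu : {measure set T -> \bar R}) (w : T -> R).

(** A real density, nonnegative at every point, instead of the extended-real Radon-Nikodym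
    derivative: such densities can be averaged, divided and composed with [phi] pointwise. *)
Definition has_density nu mu w : Prop :=
  [/\ measurable_fun setT w, forall x, 0 <= w x &
      forall A, measurable A -> nu A = (\int[mu]_(x in A) (w x)%:E)%E].

Lemma integral_density nu mu w (f : T -> \bar R) : has_density nu mu w ->
  measurable_fun setT f -> (forall x, 0 <= f x)%E ->
  (\int[nu]_x f x = \int[mu]_x (f x * (w x)%:E))%E.
Proof.
move=> [mw w0 nuE] mf f0.
have mwE : measurable_fun setT (EFin \o w) by exact/measurable_EFinP.
pose h := nnsfun_approx measurableT mf.
have h_cvg x : (EFin \o h n) x @[n --> \oo] --> f x.
  by apply: cvg_nnsfun_approx => // y _; exact: f0.
have h_nd x : {homo (fun n => (h n x)%:E) : a b / (a <= b)%N >-> (a <= b)%E}.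
  by move=> a b ab; rewrite lee_fin; exact/lefP/nd_nnsfun_approx.
have mh n : measurable_fun setT (fun x => (h n x)%:E) by exact/measurable_EFinP.
have stepE n : (\int[nu]_x (h n x)%:E = \int[mu]_x ((h n x)%:E * (w x)%:E))%E.
  have hE x : ((h n x)%:E =
      \sum_(y \in range (h n)) (y * \1_(h n @^-1` [set y]) x)%:E)%E.
    by rewrite [in LHS]fimfunE -fsumEFin.
  have mterm y : measurable_fun setT (fun x => (y * \1_(h n @^-1` [set y]) x)%:E).
    by apply/measurable_EFinP; exact: measurable_funM.
  under eq_integral do rewrite hE.
  under [RHS]eq_integral => x _.
    rewrite hE ge0_mule_fsuml; last by move=> y; exact: nnfun_muleindic_ge0.
    over.
  rewrite /= !ge0_integral_fsum//; last 3 first.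
  - by move=> y; exact: emeasurable_funM.
  - by move=> y x _; rewrite mule_ge0 ?lee_fin//; exact: nnfun_muleindic_ge0.
  - by move=> y x _; exact: nnfun_muleindic_ge0.
  apply: eq_fsbigr => y /[!inE] -[t _ <-].
  have mA : measurable (h n @^-1` [set h n t]).
    by rewrite -[X in measurable X]setTI; exact: measurable_funP.
  under eq_integral do rewrite EFinM.
  under [RHS]eq_integral do rewrite EFinM -muleA.
  have mI : measurable_fun setT (fun x => (\1_(h n @^-1` [set h n t]) x : R)%:E).
    exact/measurable_EFinP.
  have hn0 : (0 <= (h n t)%:E)%E by rewrite lee_fin.
  have mIw : measurable_fun setT
      (fun x => (\1_(h n @^-1` [set h n t]) x)%:E * (w x)%:E)%E.
    exact: emeasurable_funM.
  rewrite ge0_integralZl// ge0_integralZl//; last first.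
    by move=> x _; rewrite mule_ge0// lee_fin.
  congr (_ * _)%E; rewrite integral_indic// setIT nuE//.
  rewrite integral_mkcond; apply: eq_integral => x _.
  by rewrite patchE indicE; case: ifPn => _; rewrite ?mul1e ?mul0e.
transitivity (lim (\int[nu]_x (h n x)%:E @[n --> \oo])%E).
  rewrite -monotone_convergence//.
  - by apply: eq_integral => x _; apply/esym/cvg_lim => //; exact: h_cvg.
  - by move=> n x _; rewrite lee_fin.
under eq_fun do rewrite stepE.
rewrite -monotone_convergence//.
- apply: eq_integral => x _; apply/cvg_lim => //.
  by apply: cvgeZr => //; exact: h_cvg.
- by move=> n; exact: emeasurable_funM.
- by move=> n x _; rewrite mule_ge0 ?lee_fin.
- by move=> x _ a b ab; rewrite lee_wpmul2r ?lee_fin//; exact/lefP/nd_nnsfun_approx.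
Qed.

End Density.

(** * Pointwise inequalities for the integrand of the entropy *)

Section Phi.
Context (R : realType).
Implicit Types x y : R.

(* Subtracting x - 1 makes the integrand of the entropy nonnegative without
   changing its integral; [ln 0 = 0] gives the right value 1 at 0. *)
Definition phi x : R := x * ln x - x + 1.


Lemma ln_le_subr1 x : 0 < x -> ln x <= x - 1.
Proof.
by move=> x0; rewrite -{1}(subrK 1 x) addrC le_ln1Dx// ltrBrDr addNr.
Qed.

Lemma phi_ge0 x : 0 <= x -> 0 <= phi x.
Proof.
rewrite le_eqVlt /phi => /predU1P[<-|x0]; first by rewrite mul0r subr0 add0r.
have := @ln_le_subr1 x^-1; rewrite invr_gt0 lnV ?posrE// => /(_ x0).
rewrite -(ler_pM2l x0) mulrBr divff ?gt_eqF// mulrN => h; lra.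
Qed.

(** Convexity in tangent form, as [ln] is the derivative of [phi]. For y > 0 it is
    [ln (x / y) <= x / y - 1] multiplied by y. *)
Lemma phi_tangent x y : 0 < x -> 0 <= y -> phi x + ln x * (y - x) <= phi y.
Proof.
move=> x0; rewrite /phi le_eqVlt => /predU1P[<-|y0].
  by rewrite mul0r; nra.
have := ln_le_subr1 (divr_gt0 x0 y0); rewrite ln_div ?posrE//.
rewrite -(ler_pM2l y0) mulrBr mulrBr mulr1 mulrCA divff ?gt_eqF// => h; nra.
Qed.

(** Jensen's inequality, by averaging the tangent inequality at the mean. The tangent at 0 is
    vertical, so mean 0 is treated apart: there every selected [x j] vanishes. *)
Lemma phi_mean n (P : pred 'I_n) (c : R) (x : 'I_n -> R) :
  0 <= c -> c * \sum_(j < n | P j) 1 = 1 -> (forall j, 0 <= x j) ->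
  phi (c * \sum_(j < n | P j) x j) <= c * \sum_(j < n | P j) phi (x j).
Proof.
move=> c0 c1 x0; set m := c * _.
have : 0 <= m by rewrite mulr_ge0// sumr_ge0.
rewrite le_eqVlt => /predU1P[m0|m_gt0].
  have cgt0 : 0 < c.
    by rewrite lt0r c0 andbT; apply/eqP => cE; move: c1; rewrite cE mul0r => /esym/eqP; rewrite oner_eq0.
  rewrite -m0 (_ : phi 0 = c * \sum_(j < n | P j) phi 0); last first.
    by rewrite -[X in \sum_(_ < _ | _) X]mulr1 -mulr_sumr mulrCA c1 mulr1.
  rewrite ler_pM2l//; apply: ler_sum => j Pj.
  have /eqP := esym m0; rewrite /m mulf_eq0 gt_eqF//= psumr_eq0//.
  by move=> /allP/(_ j); rewrite mem_index_enum Pj/= => /(_ isT)/eqP ->.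
have -> : phi m = c * \sum_(j < n | P j) (phi m + ln m * (x j - m)).
  rewrite big_split/= -mulr_sumr sumrB mulrDr.
  have sE z : c * \sum_(j < n | P j) z = z.
    by rewrite -[X in \sum_(_ < _ | _) X]mulr1 -mulr_sumr mulrCA c1 mulr1.
  by rewrite sE mulrCA mulrBr sE -/m subrr mulr0 addr0.
by rewrite ler_wpM2l//; apply: ler_sum => j Pj; exact: phi_tangent.
Qed.

(** The sign condition puts c on the same side of 1 as x, which lets the sign of a derivative be
    integrated from 1 in both directions at once. *)
Lemma MVT_at1 (f df : R -> R) x : 0 < x -> x != 1 ->
  (forall y, 0 < y -> is_derive y (1:R) f (df y)) ->
  exists c, [/\ 0 < c, 0 < (c - 1) * (x - 1) & f x - f 1 = df c * (x - 1)].
Proof.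
move=> x0 x1 fd.
have fc y : 0 < y -> {for y, continuous f}.
  by move=> y0; apply: differentiable_continuous; apply/derivable1_diffP; case: (fd y y0).
have fcw a b : 0 < a -> {within `[a, b], continuous f}.
  move=> a0; apply: continuous_in_subspaceT => y; rewrite inE/= in_itv/= => /andP[ay _].
  by apply: fc; exact: lt_le_trans ay.
have [lt1|gt1|x1'] := ltgtP x 1; last by rewrite x1' eqxx in x1.
- have fd' y : y \in `]x, 1[%R -> is_derive y (1:R) f (df y).
    by rewrite in_itv/= => /andP[xy _]; apply: fd; exact: lt_trans xy.
  have [c] := MVT lt1 fd' (fcw _ _ x0); rewrite in_itv/= => /andP[xc c1] E.
  exists c; split; [lra|nra|].
  by rewrite -[LHS]opprB E; ring.
- have fd' y : y \in `]1, x[%R -> is_derive y (1:R) f (df y).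
    by rewrite in_itv/= => /andP[xy _]; apply: fd; exact: lt_trans xy.
  have [c] := MVT gt1 fd' (fcw _ _ ltr01); rewrite in_itv/= => /andP[xc c1] E.
  by exists c; split => //; [lra|nra].
Qed.

(** Let g = phi - 3 (y - 1)^2 / (4 + 2 y) and let k be its derivative. Both vanish at 1, and k' = (y
    - 1)^2 (y + 8) / (y (y + 2)^3) is nonnegative, so k has the sign of y - 1 and g is minimal at
    1. *)
Lemma pinsker_pointwise x : 0 <= x -> 3 * (x - 1) ^+ 2 <= (4 + 2 * x) * phi x.
Proof.
rewrite le_eqVlt => /predU1P[<-|x0].
  by rewrite /phi mul0r; lra.
pose k y : R := ln y - 3 / 2 * (1 - 9 * (y + 2)^-1 ^+ 2).
have k_ge0 y : 0 < y -> 0 <= k y * (y - 1).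
  move=> y0; have [->|y1] := eqVneq y 1; first by rewrite subrr mulr0.
  have [z z0|c [c0 _ E]] := @MVT_at1 k (fun y => y^-1 - 27 * (y + 2)^-1 ^+ 3) y y0 y1.
    rewrite /k; have z2 : z + 2 != 0 by rewrite gt_eqF// ltr_wpDr.
    have := is_derive1_ln z0 => dln.
    apply: is_derive_eq.
    by rewrite /GRing.scale/=; field; rewrite z2 gt_eqF.
  have k1 : k 1 = 0 by rewrite /k ln1; field.
  rewrite k1 subr0 in E; rewrite E -mulrA -expr2 mulr_ge0 ?sqr_ge0//.
  have c2 : 0 < c + 2 by lra.
  rewrite (_ : _ - _ = ((c - 1) ^+ 2 * (c + 8)) * (c^-1 * (c + 2)^-1 ^+ 3)).
    apply: mulr_ge0; first by apply: mulr_ge0; [exact: sqr_ge0|lra].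
    by apply: mulr_ge0; [|apply: exprn_ge0]; rewrite invr_ge0 ltW.
  by field; rewrite !gt_eqF.
(* The subtracted quotient is written in partial fractions: (y - 1)^2 / (y + 2) = y - 4 + 9 / (y +
   2). *)
pose g y : R := phi y - 3 / 2 * (y - 4 + 9 * (y + 2)^-1).
have g_ge0 : 0 <= g x.
  have g1 : g 1 = 0 by rewrite /g /phi ln1; field.
  have [->|x1] := eqVneq x 1; first by rewrite g1.
  have [z z0|c [c0 c1 E]] := @MVT_at1 g k x x0 x1.
    rewrite /k /g /phi; have z2 : z + 2 != 0 by rewrite gt_eqF// ltr_wpDr.
    have := is_derive1_ln z0 => dln.
    apply: is_derive_eq.
    by rewrite /GRing.scale/=; field; rewrite z2 gt_eqF.
  rewrite g1 subr0 in E; rewrite E.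
  rewrite -(pmulr_rge0 _ c1).
  have -> : (c - 1) * (x - 1) * (k c * (x - 1)) = k c * (c - 1) * (x - 1) ^+ 2.
    by move: (k c) => kc; ring.
  by rewrite mulr_ge0 ?sqr_ge0 ?k_ge0.
have x2 : 0 < x + 2 by lra.
rewrite -subr_ge0 (_ : _ - _ = 2 * (x + 2) * g x).
  by apply: mulr_ge0 => //; lra.
by rewrite /g; field; rewrite gt_eqF.
Qed.

End Phi.

Section DensityTheory.
Context d (T : measurableType d) (R : realType).
Implicit Types (mu nu : {measure set T -> \bar R}) (w f g : T -> R).

Lemma measurable_sum_cond (D : set T) I (s : seq I) (P : pred I) (h : I -> T -> R) :
  (forall i, measurable_fun D (h i)) ->
  measurable_fun D (fun x => \sum_(i <- s | P i) h i x).
Proof.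
by move=> mh; under eq_fun do rewrite -big_filter; exact: measurable_sum.
Qed.

Lemma emeasurable_sum_cond (D : set T) I (s : seq I) (P : pred I)
    (h : I -> T -> \bar R) :
  (forall i, measurable_fun D (h i)) ->
  measurable_fun D (fun x => \sum_(i <- s | P i) h i x)%E.
Proof.
by move=> mh; under eq_fun do rewrite -big_filter; exact: emeasurable_sum.
Qed.

Lemma ge0_integral_sum_cond mu (D : set T) I (s : seq I) (P : pred I)
    (h : I -> T -> \bar R) : measurable D ->
  (forall i, measurable_fun D (h i)) -> (forall i x, 0 <= h i x)%E ->
  (\int[mu]_(x in D) (\sum_(i <- s | P i) h i x) =
   \sum_(i <- s | P i) \int[mu]_(x in D) h i x)%E.
Proof.
move=> mD mh h0; under eq_integral do rewrite -big_filter.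
by rewrite ge0_integral_sum// big_filter.
Qed.

Lemma has_density_dominates nu mu w : has_density nu mu w -> nu `<< mu.
Proof.
move=> [mw w0 nuE]; apply/null_content_dominatesP => A mA A0.
by rewrite nuE// null_set_integral//; exact/measurable_EFinP/measurable_funTS.
Qed.

Lemma has_density_integrable (nu : probability T R) mu w :
  has_density nu mu w -> mu.-integrable setT (EFin \o w).
Proof.
move=> [mw w0 nuE]; apply/integrableP; split; first exact/measurable_EFinP.
under eq_integral do rewrite /= ger0_norm//.
by rewrite -nuE// [X in (X < _)%E]probability_setT ltry.
Qed.

Lemma integrable_density nu mu w f : has_density nu mu w ->
  nu.-integrable setT (EFin \o f) ->
  mu.-integrable setT (fun x => (f x * w x)%:E) /\
  (\int[nu]_x (f x)%:E = \int[mu]_x (f x * w x)%:E)%E.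
Proof.
move=> wd fi; have [mw w0 _] := wd.
have mf : measurable_fun setT f by exact/measurable_EFinP/(measurable_int _ fi).
have mfw : measurable_fun setT (fun x => (f x * w x)%:E).
  by apply/measurable_EFinP; exact: measurable_funM.
split.
  apply/integrableP; split => //.
  have /integrableP[_] := fi; apply: le_lt_trans.
  rewrite (integral_density wd)//; last by apply: measurableT_comp => //; exact/measurable_EFinP.
  apply: ge0_le_integral => //.
  - exact: measurableT_comp.
  - apply: emeasurable_funM; last exact/measurable_EFinP.
    by apply: measurableT_comp => //; exact/measurable_EFinP.
  - by move=> x _ /=; rewrite lee_fin normrM (ger0_norm (w0 x)).
rewrite integralE [RHS]integralE !(integral_density wd)//; last 2 first.
- by apply: measurable_funeneg; exact/measurable_EFinP.
- by apply: measurable_funepos; exact/measurable_EFinP.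
congr (_ - _)%E; apply: eq_integral => x _.
- by rewrite !funeposE/= -!EFin_max -EFinM maxr_pMl// mul0r.
- by rewrite !funenegE/= -!EFin_max -EFinM maxr_pMl// mul0r mulNr.
Qed.

(** The integral of [f] may be +oo, as happens for entropies. Since f >= - g, the negative part of
    [f] is dominated by |g|, so no difference of infinities arises. *)
Lemma integralD_integrable mu f g : measurable_fun setT f ->
  mu.-integrable setT (EFin \o g) -> (forall x, 0 <= f x + g x) ->
  (\int[mu]_x (f x + g x)%:E = \int[mu]_x (f x)%:E + \int[mu]_x (g x)%:E)%E.
Proof.
move=> mf gi fg0.
have mg : measurable_fun setT g by exact/measurable_EFinP/(measurable_int _ gi).
have mfg : measurable_fun setT (fun x => (f x + g x)%:E).
  by apply/measurable_EFinP; exact: measurable_funD.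
have gfin : (\int[mu]_x (g x)%:E)%E \is a fin_num by exact: integrable_fin_num.
have [fgi|fgy] := boolP (\int[mu]_x (f x + g x)%:E < +oo)%E.
  have fgI : mu.-integrable setT (EFin \o (f \+ g)).
    apply/integrableP; split => //.
    by under eq_integral do rewrite /= ger0_norm//.
  have -> : (\int[mu]_x (f x)%:E = \int[mu]_x ((f x + g x)%:E - (g x)%:E))%E.
    by apply: eq_integral => x _; rewrite EFinD addeK.
  by rewrite integralB_EFin//= subeK.
have {}fgy : (\int[mu]_x (f x + g x)%:E = +oo)%E.
  by move: fgy; rewrite ltey negbK => /eqP.
have fn : (\int[mu]_x (EFin \o f)^\- x < +oo)%E.
  have /integrableP[_] := gi; apply: le_lt_trans.
  apply: ge0_le_integral => //.
  - by apply: measurable_funeneg; exact/measurable_EFinP.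
  - by apply: measurableT_comp => //; exact/measurable_EFinP.
  - move=> x _; rewrite funenegE/= -EFin_max lee_fin ge_max normr_ge0 andbT.
    by rewrite (le_trans _ (ler_norm _))// -subr_ge0 opprK addrC.
have fp : (\int[mu]_x (EFin \o f)^\+ x = +oo)%E.
  have mfp : measurable_fun setT ((EFin \o f)^\+)%E.
    by apply: measurable_funepos; exact/measurable_EFinP.
  have mgn : measurable_fun setT (fun x => `|(g x)%:E|)%E.
    by apply: measurableT_comp => //; exact/measurable_EFinP.
  apply/eqP; rewrite -leye_eq leNgt; apply/negP => fpy.
  have : (\int[mu]_x (f x + g x)%:E < +oo)%E; last by rewrite fgy ltxx.
  have /integrableP[_ gl] := gi.
  apply: le_lt_trans (lte_add_pinfty fpy gl).
  rewrite -ge0_integralD//.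
  apply: ge0_le_integral => //.
  - by move=> x _; rewrite lee_fin.
  - exact: emeasurable_funD.
  - move=> x _; rewrite funeposE/= -EFin_max -EFinD lee_fin lerD// ?ler_norm//.
    by rewrite le_max lexx.
rewrite fgy [X in _ = (X + _)%E]integralE fp.
move: gfin fn;
by case: (\int[mu]_x (g x)%:E)%E => // r _; case: (\int[mu]_x (EFin \o f)^\- x)%E.
Qed.

End DensityTheory.

Section Entropy.
Context (R : realType) (dim : nat).
Local Notation X := 'rV[R]_dim.
Implicit Types (m nu xi : probability X R) (h g : X -> R).

Lemma measurable_phi d (T : measurableType d) (D : set T) (h : T -> R) :
  measurable_fun D h -> measurable_fun D (fun x => phi (h x)).
Proof.
move=> mh; apply: measurable_funD => //; apply: measurable_funB => //.
by apply: measurable_funM => //; exact: measurableT_comp.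
Qed.

(** The Radon-Nikodym derivative agrees with [h] only m-almost everywhere; domination turns this
    into nu-almost everywhere, where the entropy integrates its logarithm. The added term 1 - h has
    m-integral 0. *)
Lemma rel_entropy_density nu m h : has_density nu m h ->
  rel_entropy nu m = (\int[m]_x (phi (h x))%:E)%E.
Proof.
move=> hd; have [mh h0 nuE] := hd.
have dom := has_density_dominates hd.
have mlnh : measurable_fun setT (fun x => ln (h x)) by exact: measurableT_comp.
have hi := has_density_integrable hd.
have mrn : measurable_fun setT (rn_density nu m).
  exact: (measurableT_comp (f := fine)).
rewrite /rel_entropy asboolT//.
transitivity (\int[nu]_x (ln (h x))%:E)%E.
  apply: ae_eq_integral => //.
  - by apply/measurable_EFinP; apply: measurableT_comp => //.
  - exact/measurable_EFinP.
  - apply: (null_dominates_ae_eq measurableT dom).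
    have : ae_eq m setT (Radon_Nikodym (charge_of_finite_measure nu) m) (EFin \o h).
      apply: integral_ae_eq => //.
      - exact: Radon_Nikodym_integrable.
      - exact/measurable_EFinP.
      - by move=> A _ mA; rewrite -Radon_Nikodym_integral//= nuE.
    by apply: filterS => x /= hx I; rewrite /rn_density hx.
have mhlnh : measurable_fun setT (fun x => ln (h x) * h x) by exact: measurable_funM.
have -> : (\int[nu]_x (ln (h x))%:E = \int[m]_x (ln (h x) * h x)%:E)%E.
  rewrite integralE [RHS]integralE !(integral_density hd)//; last 2 first.
  - by apply: measurable_funeneg; exact/measurable_EFinP.
  - by apply: measurable_funepos; exact/measurable_EFinP.
  congr (_ - _)%E; apply: eq_integral => x _.
  - by rewrite !funeposE/= -!EFin_max -EFinM maxr_pMl// mul0r.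
  - by rewrite !funenegE/= -!EFin_max -EFinM maxr_pMl// mul0r mulNr.
have ci : m.-integrable setT (EFin \o (fun x => 1 - h x)).
  have -> : EFin \o (fun x => 1 - h x) = ((EFin \o cst 1%R) \- (EFin \o h))%E.
    by apply/funext.
  by apply: integrableB => //; exact: finite_measure_integrable_cst.
have c0 : (\int[m]_x (1 - h x)%:E = 0)%E.
  rewrite integralB_EFin//; last exact: finite_measure_integrable_cst.
  rewrite -nuE// integral_cst// mul1e [X in (X - _)%E]probability_setT.
  by rewrite [X in (_ - X)%E]probability_setT subee.
under [RHS]eq_integral => x _.
  rewrite (_ : phi _ = ln (h x) * h x + (1 - h x)); last by rewrite /phi; ring.
  over.
rewrite /= integralD_integrable//; first by rewrite c0 adde0.
move=> x; rewrite (_ : _ + _ = phi (h x)) ?phi_ge0//; rewrite /phi; ring.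
Qed.

(** [Radon_Nikodym_SigmaFinite.f] is chosen because it is finite and nonnegative at every point, as
    [has_density] demands. *)
Lemma dominates_density nu m : nu `<< m -> exists h, has_density nu m h.
Proof.
move=> dom; pose f := Radon_Nikodym_SigmaFinite.f nu m.
have fE x : (fine (f x))%:E = f x.
  by rewrite fineK// Radon_Nikodym_SigmaFinite.f_fin_num.
exists (fine \o f); split => [|x|A mA].
- apply: measurableT_comp => //.
  exact: (measurable_int _ (Radon_Nikodym_SigmaFinite.f_integrable dom)).
- by rewrite fine_ge0// Radon_Nikodym_SigmaFinite.f_ge0.
- under eq_integral do rewrite /= fE.
  exact: Radon_Nikodym_SigmaFinite.f_integral.
Qed.

Lemma rel_entropy_lty_density nu m : (rel_entropy nu m < +oo)%E ->
  exists h, has_density nu m h.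
Proof.
by rewrite /rel_entropy; case: asboolP => // dom _; exact: dominates_density.
Qed.

Lemma rel_entropy_ge0 nu m : (0 <= rel_entropy nu m)%E.
Proof.
have [dom|ndom] := pselect (nu `<< m); last first.
  by rewrite /rel_entropy asboolF.
have [h hd] := dominates_density dom; rewrite (rel_entropy_density hd).
by apply: integral_ge0 => x _; rewrite lee_fin phi_ge0//; case: hd.
Qed.

Lemma has_density_sum n (P : pred 'I_n) c nu m (xi : 'I_n -> probability X R)
    (h : 'I_n -> X -> R) : 0 <= c ->
  (forall A, measurable A -> nu A = c%:E * \sum_(j < n | P j) xi j A)%E ->
  (forall j, has_density (xi j) m (h j)) ->
  has_density nu m (fun x => c * \sum_(j < n | P j) h j x).
Proof.
move=> c0 nuE hd; split => [|x|A mA].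
- apply: measurable_funM => //;
  by apply: measurable_sum_cond => j; case: (hd j).
- by rewrite mulr_ge0// sumr_ge0// => j _; case: (hd j).
- have mhj j : measurable_fun A (EFin \o h j).
    by apply/measurable_EFinP/measurable_funTS; case: (hd j).
  have hj0 j x : (0 <= (h j x)%:E)%E by rewrite lee_fin; case: (hd j).
  rewrite [LHS](nuE _ mA); under [RHS]eq_integral do rewrite EFinM -sumEFin.
  rewrite ge0_integralZl//; last 2 first.
  - exact: emeasurable_sum_cond.
  - by move=> x _; apply: sume_ge0.
  rewrite ge0_integral_sum_cond//; congr (_ * _)%E; apply: eq_bigr => j _.
  by case: (hd j) => _ _ ->.
Qed.

(** Convexity of the entropy, by [phi_mean] at each point. Describing the mixture by a predicate and
    a weight covers both the mean over j != i and the mean over all indices. *)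
Lemma rel_entropy_mean n (P : pred 'I_n) c nu m (xi : 'I_n -> probability X R) :
  0 <= c ->
  (forall A, measurable A -> nu A = c%:E * \sum_(j < n | P j) xi j A)%E ->
  (forall j, (rel_entropy (xi j) m < +oo)%E) ->
  (rel_entropy nu m <= c%:E * \sum_(j < n | P j) rel_entropy (xi j) m)%E.
Proof.
move=> c0 nuE fin.
have /choice[h hd] : forall j, exists h, has_density (xi j) m h.
  by move=> j; exact: rel_entropy_lty_density.
have c1 : c * \sum_(j < n | P j) 1 = 1.
  have := nuE _ measurableT; rewrite [LHS]probability_setT.
  rewrite (eq_bigr (fun=> 1%E)); last by move=> j _; exact: probability_setT.
  by rewrite sumEFin -EFinM => -[] /esym.
rewrite (rel_entropy_density (has_density_sum c0 nuE hd)).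
under eq_bigr do rewrite (rel_entropy_density (hd _)).
have mh j : measurable_fun setT (fun x => phi (h j x)).
  by apply: measurable_phi; case: (hd j).
have h0 j x : 0 <= h j x by case: (hd j).
have p0 j x : (0 <= (phi (h j x))%:E)%E by rewrite lee_fin phi_ge0.
rewrite -ge0_integral_sum_cond//; last by move=> j; exact/measurable_EFinP.
rewrite -ge0_integralZl//; last 2 first.
- by apply: emeasurable_sum_cond => j; exact/measurable_EFinP.
- by move=> x _; apply: sume_ge0.
apply: ge0_le_integral => //.
- by move=> x _; rewrite lee_fin phi_ge0// mulr_ge0// sumr_ge0.
- apply/measurable_EFinP/measurable_phi/measurable_funM => //.
  by apply: measurable_sum_cond => j; case: (hd j).
- apply: emeasurable_funM => //; apply: emeasurable_sum_cond => j.
  exact/measurable_EFinP.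
- by move=> x _; rewrite sumEFin -EFinM lee_fin; exact: phi_mean.
Qed.

(** Chain rule for entropies, valid also when they are +oo. If [xi] is not dominated by [m], it is
    not dominated by [pi] either and both sides are +oo. Otherwise h / g is the density of [xi] with
    respect to [pi], and the pointwise identity [E] is integrated against [m]. *)
Lemma rel_entropy_change xi m (pi : probability X R) g : has_density pi m g ->
  (forall x, 0 < g x) -> xi.-integrable setT (fun x => (ln (g x))%:E) ->
  rel_entropy xi pi = (rel_entropy xi m - \int[xi]_x (ln (g x))%:E)%E.
Proof.
move=> gd g0 lgi; have [mg _ piE] := gd.
have lfin := integrable_fin_num measurableT lgi.
have pim := has_density_dominates gd.
have [dom|ndom] := pselect (xi `<< m); last first.
  have ndom' : ~ xi `<< pi by move=> /null_dominates_trans/(_ pim).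
  by rewrite /rel_entropy !asboolF//; case: (\int[_]_x _)%E lfin.
have [h hd] := dominates_density dom; have [mh h0 xiE] := hd.
have mr : measurable_fun setT (fun x => h x / g x).
  rewrite (_ : (fun x => _) = (fun x => h x * expR (- ln (g x)))); last first.
    by apply/funext => x; rewrite expRN lnK ?posrE.
  apply: measurable_funM => //; apply: measurableT_comp => //.
  by apply: measurableT_comp => //; exact: measurableT_comp.
have r0 x : 0 <= h x / g x by rewrite divr_ge0// ltW.
have hgd : has_density xi pi (fun x => h x / g x).
  split => // A mA; rewrite integral_mkcond (integral_density gd).
  - rewrite xiE// integral_mkcond; apply: eq_integral => x _.
    rewrite !patchE; case: ifPn => _; last by rewrite mul0e.
    by rewrite -EFinM divfK// gt_eqF.
  - apply/measurable_restrict => //; rewrite setTI.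
    by apply/measurable_funTS/measurable_EFinP.
  - by move=> x; rewrite patchE; case: ifPn => // _; rewrite lee_fin.
rewrite (rel_entropy_density hgd) (rel_entropy_density hd).
rewrite (integral_density gd); last 2 first.
- exact/measurable_EFinP/measurable_phi.
- by move=> x; rewrite lee_fin phi_ge0.
have [lhi lhE] := integrable_density hd lgi.
have hi := has_density_integrable gd.
have ci : m.-integrable setT (EFin \o (fun x => g x - 1)).
  have -> : EFin \o (fun x => g x - 1) = ((EFin \o g) \- (EFin \o cst 1%R))%E.
    by apply/funext.
  by apply: integrableB => //; exact: finite_measure_integrable_cst.
have c0 : (\int[m]_x (g x - 1)%:E = 0)%E.
  rewrite integralB_EFin//; last exact: finite_measure_integrable_cst.
  rewrite -piE// integral_cst// mul1e [X in (X - _)%E]probability_setT.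
  by rewrite [X in (_ - X)%E]probability_setT subee.
have E x : phi (h x / g x) * g x = phi (h x) + (g x - 1 - ln (g x) * h x).
  have := h0 x; have gx := g0 x; rewrite le_eqVlt /phi => /predU1P[<-|hx].
    by rewrite !(mul0r,mulr0); ring.
  rewrite ln_div ?posrE//; move: (ln _) (ln _) => a b.
  by field; rewrite gt_eqF.
under eq_integral do rewrite -EFinM E.
have bi : m.-integrable setT (EFin \o (fun x => g x - 1 - ln (g x) * h x)).
  have -> : EFin \o (fun x => g x - 1 - ln (g x) * h x) =
      ((EFin \o (fun x => g x - 1)%R) \- (EFin \o (fun x => ln (g x) * h x)%R))%E.
    by apply/funext.
  exact: integrableB.
rewrite integralD_integrable//.
- by rewrite integralB_EFin// c0 add0e lhE.
- exact: measurable_phi.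
- by move=> x; rewrite -E mulr_ge0 ?phi_ge0// ltW.
Qed.

End Entropy.

(** * Kernels of quadratic growth *)

Section QuadraticGrowth.
Context (R : realType) (dim : nat).
Local Notation X := 'rV[R]_dim.
Variable S : ambient.
Implicit Types (m mu nu xi : probability X R) (f g : X -> R) (U : X * X -> R).

Lemma sqr_enorm (x : X) : enorm x ^+ 2 = \sum_i x 0 i ^+ 2.
Proof. by rewrite sqr_sqrtr// sumr_ge0// => i _; exact: sqr_ge0. Qed.

Lemma enorm_ge0 (x : X) : 0 <= enorm x.
Proof. exact: sqrtr_ge0. Qed.

Lemma measurable_sqr_enorm : measurable_fun [set: X] (fun x => enorm x ^+ 2).
Proof.
under eq_fun do rewrite sqr_enorm.
apply: measurable_sum => i; apply: measurable_funX.
exact: (measurable_rv_coord (R := R) i).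
Qed.

Lemma P2_carrier nu : P2 S nu -> {ae nu, forall x, carrier S x}.
Proof.
move=> hnu; exists (~` carrier S); split => //.
- by apply: measurableC; exact: measurable_carrier.
- rewrite probability_setC; last exact: measurable_carrier.
  suff -> : nu (carrier S) = 1%E by rewrite subee.
  by move: hnu; rewrite /P2 /carrier; case: S => // _; exact: probability_setT.
Qed.

Lemma P2_moment nu : P2 S nu -> (\int[nu]_x (enorm x ^+ 2)%:E < +oo)%E.
Proof.
move=> hnu; case: S hnu (P2_carrier hnu) => //= _ hc.
apply: (@le_lt_trans _ _ (\int[nu]_x (dim%:R)%:E)%E).
  apply: ae_ge0_le_integral => //.
  - by move=> x _; rewrite lee_fin sqr_ge0.
  - by apply/measurable_EFinP; exact: measurable_sqr_enorm.
  - apply: filterS hc => x cx _; rewrite lee_fin sqr_enorm.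
    apply: (@le_trans _ _ (\sum_(i < dim) 1)).
      apply: ler_sum => i _; have /andP[h0 h1] := cx i.
      by rewrite expr_le1// ltW.
    by rewrite sumr_const card_ord.
rewrite integral_cst//; apply: lte_mul_pinfty => //.
by rewrite [X in (X < _)%E]probability_setT ltry.
Qed.

(** The bound is asked on the carrier only, which is where [quadratic_growth] gives it. Measures in
    [P2 S] do not charge the complement, so comparisons of integrals go through [P2_carrier]. *)
Definition qgrowth f : Prop := measurable_fun setT f /\
  exists C : R, forall x, carrier S x -> `|f x| <= C * (1 + enorm x ^+ 2).

Lemma qgrowth_ge0 f : qgrowth f -> measurable_fun setT f /\
  exists C : R, 0 <= C /\ forall x, carrier S x -> `|f x| <= C * (1 + enorm x ^+ 2).
Proof.
move=> [mf [C hC]]; split => //; exists `|C|; split => // x cx.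
apply: le_trans (hC x cx) _; rewrite ler_wpM2r ?ler_norm//.
by rewrite addr_ge0 ?sqr_ge0.
Qed.

Lemma qgrowth_cst (c : R) : qgrowth (fun=> c).
Proof.
split => //; exists `|c| => x _; rewrite ler_peMr// lerDl; exact: sqr_ge0.
Qed.

Lemma qgrowthD f g : qgrowth f -> qgrowth g -> qgrowth (fun x => f x + g x).
Proof.
move=> [mf [C hC]] [mg [D hD]]; split; first exact: measurable_funD.
exists (C + D) => x cx; rewrite mulrDl (le_trans (ler_normD _ _))//.
by rewrite lerD// ?hC ?hD.
Qed.

Lemma qgrowthZ c f : qgrowth f -> qgrowth (fun x => c * f x).
Proof.
move=> [mf [C hC]]; split; first exact: measurable_funM.
by exists (`|c| * C) => x cx; rewrite normrM -mulrA ler_wpM2l// hC.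
Qed.

Lemma qgrowthB f g : qgrowth f -> qgrowth g -> qgrowth (fun x => f x - g x).
Proof.
move=> qf qg; have := qgrowthD qf (qgrowthZ (-1) qg).
by congr qgrowth; apply/funext => x; rewrite mulN1r.
Qed.

Lemma moment_cst_lty nu C D : P2 S nu -> 0 <= C -> 0 <= D ->
  (\int[nu]_x (C + D * enorm x ^+ 2)%:E < +oo)%E.
Proof.
move=> hnu C0 D0; under eq_integral do rewrite EFinD EFinM.
have me : measurable_fun [set: X] (fun x => (enorm x ^+ 2)%:E).
  by apply/measurable_EFinP; exact: measurable_sqr_enorm.
rewrite ge0_integralD//; last 2 first.
- by move=> x _; rewrite mule_ge0// lee_fin sqr_ge0.
- exact: emeasurable_funM.
rewrite ge0_integralZl//; last by move=> x _; rewrite lee_fin sqr_ge0.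
apply: lte_add_pinfty.
  rewrite integral_cst//; apply: lte_mul_pinfty => //.
  by rewrite [X in (X < _)%E]probability_setT ltry.
by apply: lte_mul_pinfty => //; exact: P2_moment.
Qed.

Lemma qgrowth_integrable nu f : P2 S nu -> qgrowth f ->
  nu.-integrable setT (EFin \o f).
Proof.
move=> hnu /qgrowth_ge0[mf [C [C0 hC]]].
apply/integrableP; split; first exact/measurable_EFinP.
apply: le_lt_trans (moment_cst_lty hnu C0 C0).
apply: ae_ge0_le_integral => //.
- by apply: measurableT_comp => //; exact/measurable_EFinP.
- by move=> x _; rewrite lee_fin addr_ge0// mulr_ge0// sqr_ge0.
- apply/measurable_EFinP/measurable_funD => //; apply: measurable_funM => //.
  exact: measurable_sqr_enorm.
- apply: filterS (P2_carrier hnu) => x cx _ /=.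
  by rewrite lee_fin (le_trans (hC x cx))// mulrDr mulr1.
Qed.

Lemma le_Rintegral_carrier nu f g : P2 S nu ->
  nu.-integrable setT (EFin \o f) -> nu.-integrable setT (EFin \o g) ->
  (forall x, carrier S x -> f x <= g x) -> \int[nu]_x f x <= \int[nu]_x g x.
Proof.
move=> hnu fi gi fg.
have mf : measurable_fun setT f by apply/measurable_EFinP; case/integrableP: fi.
have mg : measurable_fun setT g by apply/measurable_EFinP; case/integrableP: gi.
rewrite -subr_ge0 -RintegralB//.
rewrite (_ : \int[nu]_x _ = \int[nu]_x `|g x - f x|); first exact: Rintegral_ge0.
congr fine; apply: ae_eq_integral => //.
- by apply/measurable_EFinP; exact: measurable_funB.
- apply/measurable_EFinP; apply: measurableT_comp => //; exact: measurable_funB.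
- apply: filterS (P2_carrier hnu) => x cx _ /=.
  by rewrite ger0_norm// subr_ge0 fg.
Qed.

Lemma Rintegral_prob_cst nu (c : R) : \int[nu]_x c = c.
Proof. by rewrite Rintegral_cst// [X in fine X]probability_setT/= mulr1. Qed.

Definition qkernel U : Prop :=
  measurable_fun setT U /\ quadratic_growth S U.

Lemma qkernel_ge0 U : qkernel U -> measurable_fun setT U /\
  exists C : R, 0 <= C /\ forall x y, carrier S x -> carrier S y ->
    `|U (x, y)| <= C * (1 + enorm x ^+ 2 + enorm y ^+ 2).
Proof.
move=> [mU [C hC]]; split => //; exists `|C|; split => // x y cx cy.
apply: le_trans (hC x y cx cy) _; rewrite ler_wpM2r ?ler_norm//.
by rewrite !addr_ge0 ?sqr_ge0.
Qed.

Lemma qkernel_section U x : qkernel U -> carrier S x ->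
  qgrowth (fun y => U (x, y)).
Proof.
move=> /qkernel_ge0[mU [C [C0 hC]]] cx; split; first exact: measurable_fun_pair2.
exists (C * (1 + enorm x ^+ 2)) => y cy; apply: le_trans (hC x y cx cy) _.
rewrite -mulrA ler_wpM2l//; have := sqr_ge0 (enorm x); have := sqr_ge0 (enorm y).
by move: (enorm x ^+ 2) (enorm y ^+ 2) => a b b0 a0; nra.
Qed.

Lemma qkernelD U U' : qkernel U -> qkernel U' -> qkernel (fun p => U p + U' p).
Proof.
move=> [mU [C hC]] [mV [D hD]]; split; first exact: measurable_funD.
exists (C + D) => x y cx cy; rewrite mulrDl (le_trans (ler_normD _ _))//.
by rewrite lerD// ?hC ?hD.
Qed.

Lemma qkernelZ c U : qkernel U -> qkernel (fun p => c * U p).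
Proof.
move=> [mU [C hC]]; split; first exact: measurable_funM.
by exists (`|c| * C) => x y cx cy; rewrite normrM -mulrA ler_wpM2l// hC.
Qed.

Lemma qkernel1 f : qgrowth f -> qkernel (fun p => f p.1).
Proof.
move=> /qgrowth_ge0[mf [C [C0 hC]]]; split; first exact: measurableT_comp.
exists C => x y cx cy /=; apply: le_trans (hC x cx) _.
by rewrite ler_wpM2l// lerDl sqr_ge0.
Qed.

Lemma qkernel_swap U : qkernel U -> qkernel (fun p => U (p.2, p.1)).
Proof.
move=> [mU [C hC]]; split.
  by apply: (measurableT_comp mU); exact: measurable_swap.
by exists C => x y cx cy /=; apply: le_trans (hC _ _ cy cx) _; rewrite addrAC.
Qed.

Lemma qkernel2 f : qgrowth f -> qkernel (fun p => f p.2).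
Proof. by move=> /qkernel1/qkernel_swap. Qed.

(** Outside the carrier a section of [U] may fail to be integrable, so measurability comes from
    Tonelli applied to the positive and negative parts. *)
Lemma measurable_Rintegral_section nu U : measurable_fun setT U ->
  measurable_fun setT (fun x => \int[nu]_y U (x, y)).
Proof.
move=> mU; apply: (measurableT_comp (f := fine)) => //.
have mU' : measurable_fun setT (EFin \o U) by exact/measurable_EFinP.
rewrite (_ : (fun x => _) = (fun x => \int[nu]_y ((EFin \o U)^\+ (x, y)) -
    \int[nu]_y ((EFin \o U)^\- (x, y)))%E); last first.
  apply/funext => x; rewrite integralE.
  by congr (_ - _)%E; apply: eq_integral => y _; rewrite ?funeposE ?funenegE.
apply: emeasurable_funB.
- apply: (measurable_fun_fubini_tonelli_F ((EFin \o U)^\+)%E) => //.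
  exact: measurable_funepos.
- apply: (measurable_fun_fubini_tonelli_F ((EFin \o U)^\-)%E) => //.
  exact: measurable_funeneg.
Qed.

Lemma qgrowth_Rintegral nu U : P2 S nu -> qkernel U ->
  qgrowth (fun x => \int[nu]_y U (x, y)).
Proof.
move=> hnu /[dup] qU /qkernel_ge0[mU [C [C0 hC]]].
split; first exact: measurable_Rintegral_section.
have qe : qgrowth (fun y => enorm y ^+ 2).
  split; first exact: measurable_sqr_enorm.
  by exists 1 => y _; rewrite mul1r ger0_norm ?sqr_ge0// lerDr.
pose M := \int[nu]_y enorm y ^+ 2.
have M0 : 0 <= M by apply: Rintegral_ge0 => y _; exact: sqr_ge0.
exists (C * (1 + M)) => x cx.
have qx := qkernel_section qU cx.
apply: le_trans (le_normr_Rintegral measurableT (qgrowth_integrable hnu qx)) _.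
have qb : qgrowth (fun y => C * (1 + enorm x ^+ 2) + C * enorm y ^+ 2).
  by apply: qgrowthD; [exact: qgrowth_cst|exact: qgrowthZ].
apply: (@le_trans _ _ (\int[nu]_y (C * (1 + enorm x ^+ 2) + C * enorm y ^+ 2))).
  apply: (le_Rintegral_carrier hnu) => //.
  - by apply: integrable_norm => //; exact: qgrowth_integrable.
  - exact: qgrowth_integrable.
  - by move=> y cy; rewrite -mulrDr hC.
have i1 := qgrowth_integrable hnu (qgrowth_cst (C * (1 + enorm x ^+ 2))).
have i2 := qgrowth_integrable hnu (qgrowthZ C qe).
have i3 := qgrowth_integrable hnu qe.
rewrite (RintegralD measurableT i1 i2) (RintegralZl _ measurableT i3).
rewrite Rintegral_prob_cst.
rewrite -mulrDr -mulrA ler_wpM2l// -/M; have := sqr_ge0 (enorm x).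
by move: (enorm x ^+ 2) M M0 => a b a0 b0; nra.
Qed.

Lemma qkernel_integrable mu nu U : P2 S mu -> P2 S nu -> qkernel U ->
  (mu \x nu)%E.-integrable setT (EFin \o U).
Proof.
move=> hmu hnu qU; have [mU _] := qU.
apply/(@integrable12ltyP _ _ _ _ R mu nu); first exact/measurable_EFinP.
have qaU : qkernel (fun p => `|U p|).
  case: qU => _ [C hC]; split; first exact: measurableT_comp.
  by exists C => x y cx cy; rewrite normr_id; exact: hC.
have qI := qgrowth_Rintegral hnu qaU.
have maU : measurable_fun setT (fun p => `|(EFin \o U) p|%E).
  by apply: measurableT_comp => //; exact/measurable_EFinP.
have : (\int[mu]_x `|(\int[nu]_y `|U (x, y)|)%:E| < +oo)%E.
  by case/integrableP: (qgrowth_integrable hmu qI).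
apply: le_lt_trans; apply: ae_ge0_le_integral => //.
- by move=> x _; exact: integral_ge0.
- exact: (measurable_fun_fubini_tonelli_F (fun p => `|(EFin \o U) p|%E)).
- by apply: measurableT_comp => //; apply/measurable_EFinP; case: qI.
- apply: filterS (P2_carrier hmu) => x cx _ /=.
  rewrite ger0_norm ?Rintegral_ge0// /Rintegral fineK//.
  apply: integrable_fin_num => //.
  exact: (qgrowth_integrable hnu (qkernel_section qaU cx)).
Qed.

Lemma bracketE mu nu U : P2 S mu -> P2 S nu -> qkernel U ->
  bracket U mu nu = \int[mu]_x \int[nu]_y U (x, y).
Proof.
move=> hmu hnu qU; have Ui := qkernel_integrable hmu hnu qU.
rewrite /bracket /Rintegral -(integral12_prod_meas1 Ui); congr fine.
have [mI _] := qgrowth_Rintegral hnu qU.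
apply: ae_eq_integral => //.
- exact: (measurable_fubini_F Ui).
- exact/measurable_EFinP.
- apply: filterS (P2_carrier hmu) => x cx _ /=.
  rewrite /fubini_F fineK//; apply: integrable_fin_num => //.
  exact: (qgrowth_integrable hnu (qkernel_section qU cx)).
Qed.

Lemma bracket_swap mu nu U : P2 S mu -> P2 S nu -> qkernel U ->
  bracket U mu nu = bracket (fun p => U (p.2, p.1)) nu mu.
Proof.
move=> hmu hnu qU; have Ui := qkernel_integrable hmu hnu qU.
have Vi := qkernel_integrable hnu hmu (qkernel_swap qU).
rewrite /bracket /Rintegral -(integral12_prod_meas1 Ui).
by rewrite -(integral21_prod_meas1 Vi).
Qed.

Lemma bracketC mu nu U : P2 S mu -> P2 S nu -> qkernel U ->
  symmetric_kernel U -> bracket U mu nu = bracket U nu mu.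
Proof.
move=> hmu hnu qU sU; rewrite bracket_swap//; congr bracket.
by apply/funext => -[x y] /=; rewrite sU.
Qed.

Lemma bracketD mu nu U U' : P2 S mu -> P2 S nu -> qkernel U -> qkernel U' ->
  bracket (fun p => U p + U' p) mu nu = bracket U mu nu + bracket U' mu nu.
Proof.
by move=> hmu hnu qU qV; rewrite /bracket RintegralD//; exact: qkernel_integrable.
Qed.

Lemma bracketZ mu nu c U : P2 S mu -> P2 S nu -> qkernel U ->
  bracket (fun p => c * U p) mu nu = c * bracket U mu nu.
Proof.
by move=> hmu hnu qU; rewrite /bracket RintegralZl//; exact: qkernel_integrable.
Qed.

Lemma bracket1 mu nu f : P2 S mu -> P2 S nu -> qgrowth f ->
  bracket (fun p => f p.1) mu nu = \int[mu]_x f x.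
Proof.
move=> hmu hnu qf; rewrite bracketE//; last exact: qkernel1.
by apply: eq_Rintegral => x _ /=; rewrite Rintegral_prob_cst.
Qed.

Lemma bracket2 mu nu f : P2 S mu -> P2 S nu -> qgrowth f ->
  bracket (fun p => f p.2) mu nu = \int[nu]_y f y.
Proof.
by move=> hmu hnu qf; rewrite (bracketE hmu hnu (qkernel2 qf))/= Rintegral_prob_cst.
Qed.

Lemma qkernel_sub12 U f g c : qkernel U -> qgrowth f -> qgrowth g ->
  qkernel (fun p => U p - f p.1 - g p.2 + c).
Proof.
move=> qU qf qg.
have -> : (fun p => U p - f p.1 - g p.2 + c) =
  (fun p => (U p + -1 * f p.1) + (-1 * g p.2 + c)).
  by apply/funext => p; ring.
apply: qkernelD; apply: qkernelD => //.
- exact: (@qkernel1 (fun x => -1 * f x) (qgrowthZ (-1) qf)).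
- exact: (@qkernel2 (fun x => -1 * g x) (qgrowthZ (-1) qg)).
- exact: (@qkernel1 (fun=> c) (qgrowth_cst c)).
Qed.

(** Serves both modifications of a kernel by functions of one variable: [reduced] and, later,
    [based]. *)
Lemma bracket_sub12 mu nu U f g c : P2 S mu -> P2 S nu ->
  qkernel U -> qgrowth f -> qgrowth g ->
  bracket (fun p => U p - f p.1 - g p.2 + c) mu nu =
  bracket U mu nu - \int[mu]_x f x - \int[nu]_y g y + c.
Proof.
move=> hmu hnu qU qf qg.
have qf1 := qkernelZ (-1) (qkernel1 qf); have qg2 := qkernelZ (-1) (qkernel2 qg).
have qc := qkernel1 (qgrowth_cst c).
have -> : (fun p => U p - f p.1 - g p.2 + c) =
  (fun p => (U p + -1 * f p.1) + (-1 * g p.2 + c)).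
  by apply/funext => p; ring.
rewrite bracketD//; [|exact: qkernelD..].
rewrite bracketD// bracketD// !bracketZ//; [|exact: qkernel2|exact: qkernel1].
rewrite bracket1// bracket2// (@bracket1 mu nu (fun=> c))//; last exact: qgrowth_cst.
by rewrite Rintegral_prob_cst; ring.
Qed.

(** Double centring: the right-hand side is <W, (mu - m) (x) (nu - m)> expanded, so it vanishes as
    soon as one argument is [m]. *)
Lemma bracket_reduced mu nu m W : P2 S mu -> P2 S nu -> P2 S m -> qkernel W ->
  bracket (reduced W m) mu nu =
  bracket W mu nu - bracket W mu m - bracket W m nu + bracket W m m.
Proof.
move=> hmu hnu hm qW; have qW' := qkernel_swap qW.
have qf := qgrowth_Rintegral hm qW; have qg := qgrowth_Rintegral hm qW'.
rewrite (_ : reduced W m = fun p => W p - (\int[m]_y W (p.1, y)) -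
  (\int[m]_x W (x, p.2)) + bracket W m m); last by apply/funext.
rewrite (@bracket_sub12 mu nu W (fun x => \int[m]_y W (x, y))
  (fun y => \int[m]_x W (x, y)))//.
rewrite -bracketE//; congr (_ - _ - _ + _).
by rewrite (bracket_swap hm hnu qW) bracketE.
Qed.

End QuadraticGrowth.

(** * Transport bounds for kernels *)

Section DualBounds.
Context (R : realType) (dim : nat).
Local Notation X := 'rV[R]_dim.
Variable S : ambient.
Implicit Types (m mu nu xi : probability X R) (f g h : X -> R) (U : X * X -> R).

(* A one-sided Kantorovich duality for the cost D, with tau in the role of the
   transport cost from m to xi. *)
Definition transport_bound xi m (D : X -> X -> R) (tau : R) : Prop :=
  forall f K, 0 <= K -> qgrowth S f ->
    (forall x y, carrier S x -> carrier S y -> f x - f y <= K * D x y) ->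
    \int[xi]_x f x - \int[m]_x f x <= K * tau.

(** Duality is used once in each variable. For fixed x and y the function U(x, .) - U(y, .) has
    constant L D(x, y); integrating it against xi - m shows that [g] has constant L tau, and [g] is
    then integrated in turn. *)
Lemma bracket_diff_transport xi m U D tau L : P2 S xi -> P2 S m ->
  qkernel S U -> 0 <= L -> 0 <= tau -> (forall x y, 0 <= D x y) ->
  transport_bound xi m D tau ->
  (forall x y z w, U (x, z) - U (x, w) - U (y, z) + U (y, w) <= L * D x y * D z w) ->
  bracket_diff U xi m <= L * tau ^+ 2.
Proof.
move=> hxi hm qU L0 tau0 D0 tD UD.
pose g x := \int[xi]_z U (x, z) - \int[m]_z U (x, z).
have q1 := qgrowth_Rintegral hxi qU; have q2 := qgrowth_Rintegral hm qU.
have qg : qgrowth S g by exact: qgrowthB.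
have gD x y : carrier S x -> carrier S y -> g x - g y <= L * tau * D x y.
  move=> cx cy; have qx := qkernel_section qU cx; have qy := qkernel_section qU cy.
  have := tD (fun z => U (x, z) - U (y, z)) (L * D x y) (mulr_ge0 L0 (D0 x y))
    (qgrowthB qx qy).
  rewrite !RintegralB//; [|exact: (@qgrowth_integrable _ _ S)..].
  rewrite mulrAC /g => tb.
  have : forall z w, carrier S z -> carrier S w ->
      U (x, z) - U (y, z) - (U (x, w) - U (y, w)) <= L * D x y * D z w.
    by move=> z w _ _; rewrite (le_trans _ (UD x y z w))// le_eqVlt; apply/orP; left; apply/eqP; ring.
  by move=> /tb; lra.
have := tD g (L * tau) (mulr_ge0 L0 tau0) qg gD.
rewrite /g !RintegralB//; [|exact: (@qgrowth_integrable _ _ S)..].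
by rewrite /bracket_diff !(@bracketE _ _ S)// expr2 mulrA; lra.
Qed.

Lemma density_integrable_sub1 xi m h : has_density xi m h ->
  m.-integrable setT (EFin \o (fun x => h x - 1)).
Proof.
move=> hd; have hi := has_density_integrable hd.
have -> : EFin \o (fun x => h x - 1) = ((EFin \o h) \- (EFin \o cst 1%R))%E.
  by apply/funext.
by apply: integrableB => //; exact: finite_measure_integrable_cst.
Qed.

Lemma transport_bound_tv xi m h : P2 S xi -> P2 S m -> has_density xi m h ->
  transport_bound xi m (fun _ _ => 1) ((\int[m]_x `|h x - 1|) / 2).
Proof.
move=> hxi hm hd f K K0 qf fK.
have [mh h0 _] := hd.
have c0 : carrier S (0 : X) by case: (S) => //= i; rewrite mxE lexx ltr01.
pose A := f @` carrier S.
have A0 : A !=set0 by exists (f 0); exists 0.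
have Aub x : carrier S x -> ubound A (f x + K).
  by move=> cx _ [y cy <-]; have := fK y x cy cx; rewrite mulr1; lra.
have Alb x : carrier S x -> lbound A (f x - K).
  by move=> cx _ [y cy <-]; have := fK x y cx cy; rewrite mulr1; lra.
have sA : has_sup A by split => //; exists (f 0 + K); exact: Aub.
(* On the carrier [f] oscillates by at most K, so all its values there lie within K / 2 of [c]. This
   centring is the source of the factor 1/2 in the total variation. *)
pose c := sup A - K / 2.
have fc x : carrier S x -> `|f x - c| <= K / 2.
  move=> cx; rewrite ler_distl /c.
  have h1 : f x <= sup A by apply: ub_le_sup; [case: sA|exists x].
  have h2 : sup A <= f x + K by apply: ge_sup => //; exact: Aub.
  by apply/andP; split; lra.
have qfc : qgrowth S (fun x => f x - c) by apply: qgrowthB => //; exact: qgrowth_cst.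
have fi := qgrowth_integrable hxi qfc; have fim := qgrowth_integrable hm qfc.
have [fhi fhE] := integrable_density hd fi.
have fxi := qgrowth_integrable hxi qf; have fm := qgrowth_integrable hm qf.
have ci (nu : probability X R) : nu.-integrable setT (EFin \o cst c).
  exact: finite_measure_integrable_cst.
have -> : \int[xi]_x f x - \int[m]_x f x =
    \int[xi]_x (f x - c) - \int[m]_x (f x - c).
  rewrite (RintegralB measurableT fxi (ci xi)) (RintegralB measurableT fm (ci m)).
  by rewrite !Rintegral_prob_cst; ring.
have -> : \int[xi]_x (f x - c) = \int[m]_x ((f x - c) * h x).
  by rewrite /Rintegral fhE.
rewrite -(RintegralB measurableT fhi fim).
have hi := density_integrable_sub1 hd.
have hni := integrable_norm hi.
rewrite (_ : K * _ = (K / 2) * \int[m]_x `|h x - 1|); last by ring.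
rewrite -(RintegralZl _ measurableT hni).
apply: (@le_Rintegral_carrier _ _ S) => //.
- have := integrableB measurableT fhi fim.
  by congr integrable; apply/funext.
- have := integrableZl measurableT (K / 2) hni.
  by congr integrable; apply/funext.
- move=> x cx; rewrite -{2}(mulr1 (f x - c)) -mulrBr.
  by rewrite (le_trans (ler_norm _))// normrM ler_wpM2r// fc.
Qed.

Lemma norm_le_amgm (u p q : R) : 0 <= p -> 0 <= q -> u ^+ 2 <= p * q ->
  `|u| <= (p + q) / 2.
Proof.
move=> p0 q0 h; rewrite -(ler_pXn2r (n := 2))// ?nnegrE ?divr_ge0 ?addr_ge0//.
rewrite real_normK ?num_real//; apply: le_trans h _; rewrite -subr_ge0.
by rewrite (_ : _ - _ = ((p - q) / 2) ^+ 2) ?sqr_ge0//; field.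
Qed.

(** The choice t = a recovers the square. Bounds with a free parameter t replace the Cauchy-Schwarz
    inequality for integrals, since for fixed t they can be integrated term by term. *)
Lemma sqr_le_amgm (a b : R) : 0 <= a -> 0 <= b ->
  (forall t, 0 < t -> a <= (t + b / t) / 2) -> a ^+ 2 <= b.
Proof.
move=> + b0 h; rewrite le_eqVlt => /predU1P[<-|a0]; first by rewrite expr0n.
have := h a a0; rewrite ler_pdivlMr// -(ler_pM2r a0) mulrDl divfK ?gt_eqF//; nra.
Qed.

Lemma pinsker xi m h H : has_density xi m h -> rel_entropy xi m = H%:E ->
  (\int[m]_x `|h x - 1|) ^+ 2 <= 2 * H.
Proof.
move=> hd HE; have [mh h0 hA] := hd.
have hni := integrable_norm (density_integrable_sub1 hd).
have hi := has_density_integrable hd.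
have mp : measurable_fun setT (fun x => phi (h x)) by exact: measurable_phi.
have pE := rel_entropy_density hd; rewrite HE in pE.
have p_i : m.-integrable setT (EFin \o (fun x => phi (h x))).
  apply/integrableP; split; first exact/measurable_EFinP.
  by under eq_integral do rewrite /= ger0_norm ?phi_ge0//; rewrite -pE ltry.
have hE : \int[m]_x h x = 1.
  by rewrite /Rintegral -hA// [X in fine X]probability_setT.
have {}pE : \int[m]_x phi (h x) = H by rewrite /Rintegral -pE.
have T0 : 0 <= \int[m]_x `|h x - 1| by exact: Rintegral_ge0.
have H0 : 0 <= H by rewrite -lee_fin -HE rel_entropy_ge0.
apply: sqr_le_amgm => // [|t t0]; first by rewrite mulr_ge0.
have ci : m.-integrable setT (EFin \o cst (t / 3)).
  exact: finite_measure_integrable_cst.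
have zi c g : m.-integrable setT (EFin \o g) ->
    m.-integrable setT (EFin \o (fun x => c * g x)).
  by move=> gi; have := integrableZl measurableT c gi; congr integrable; apply/funext.
have di f g : m.-integrable setT (EFin \o f) -> m.-integrable setT (EFin \o g) ->
    m.-integrable setT (EFin \o (fun x => f x + g x)).
  by move=> fi gi; have := integrableD measurableT fi gi; congr integrable; apply/funext.
have i1 := zi (t / 6) _ hi; have i2 := zi t^-1 _ p_i.
have i3 := di _ _ ci i1; have i4 := di _ _ i3 i2.
(* [pinsker_pointwise] bounds (h - 1)^2 by the product of t (2 + h) / 3 and 2 phi(h) / t. Half the
   sum of these factors is the integrand, and (2 + h) / 3 has integral 1, so the total is (t + 2 H /
   t) / 2. *)
apply: (@le_trans _ _ (\int[m]_x (t / 3 + t / 6 * h x + t^-1 * phi (h x)))).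
  apply: le_Rintegral => // x _.
  have p0 := phi_ge0 (h0 x); have pp := pinsker_pointwise (h0 x).
  have -> : t / 3 + t / 6 * h x + t^-1 * phi (h x) =
      (t * (2 + h x) / 3 + 2 * phi (h x) / t) / 2.
    by field; rewrite gt_eqF.
  apply: norm_le_amgm.
  - by rewrite divr_ge0// (mulr_ge0 (ltW t0))// addr_ge0.
  - by rewrite divr_ge0 ?mulr_ge0// ltW.
  - have -> : t * (2 + h x) / 3 * (2 * phi (h x) / t) = (4 + 2 * h x) * phi (h x) / 3.
      by field; rewrite gt_eqF.
    by rewrite ler_pdivlMr// mulrC.
rewrite (RintegralD measurableT i3 i2) (RintegralD measurableT ci i1).
rewrite (RintegralZl _ measurableT hi) (RintegralZl _ measurableT p_i).
rewrite Rintegral_prob_cst hE pE le_eqVlt; apply/orP; left; apply/eqP.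
by field; rewrite gt_eqF.
Qed.

Lemma integral_image d (T : measurableType d) (pi : probability T R) (nu : probability X R)
    (psi : T -> X) f : measurable_fun setT psi ->
  (forall A, measurable A -> pi (psi @^-1` A) = nu A) ->
  nu.-integrable setT (EFin \o f) ->
  pi.-integrable setT (EFin \o (f \o psi)) /\ \int[pi]_p f (psi p) = \int[nu]_x f x.
Proof.
move=> mpsi psiE /integrableP[mf fi].
have nuE (g : X -> \bar R) : (\int[nu]_x g x = \int[pushforward pi psi]_x g x)%E.
  by apply: eq_measure_integral => A mA _; rewrite -[LHS]psiE.
have fpi : pi.-integrable setT (EFin \o (f \o psi)).
  apply/integrableP; split; first exact: (measurableT_comp mf).
  move: fi; rewrite nuE (ge0_integral_pushforward mpsi)//.
  exact: measurableT_comp.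
by split => //; rewrite /Rintegral nuE (integral_pushforward mpsi mf).
Qed.

(** Under a coupling, r = |x - y| has mean at most sqrt A: integrate r <= (t + r^2 / t) / 2 with t =
    sqrt A. Positivity of A allows the division by t. *)
Lemma transport_bound_coupling xi m (pi : probability (X * X)%type R) A :
  S = Euclid -> P2 S xi -> P2 S m -> is_coupling xi m pi -> 0 < A ->
  (\int[pi]_p (enorm (p.1 - p.2) ^+ 2)%:E <= A%:E)%E ->
  transport_bound xi m (fun x y => enorm (x - y)) (Num.sqrt A).
Proof.
move=> SE hxi hm cpl A0 cA f K K0 qf fK.
have [mf _] := qf.
have mc : measurable_fun setT (fun p : X * X => enorm (p.1 - p.2) ^+ 2).
  under eq_fun do rewrite sqr_enorm.
  apply: measurable_sum => i; apply: measurable_funX.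
  rewrite (_ : (fun p => _) = (fun p : X * X => rv_coord i p.1 - rv_coord i p.2)).
    by apply: measurable_funB; apply: (measurableT_comp (measurable_rv_coord (R := R) i)).
  by apply/funext => p; rewrite !mxE.
have [f1i f1E] : pi.-integrable setT (EFin \o (f \o fst)) /\ \int[pi]_p f p.1 = \int[xi]_x f x.
  apply: integral_image => //; last exact: (@qgrowth_integrable _ _ S).
  by move=> B mB; have [<- _] := cpl _ mB; congr (pi _); apply/seteqP; split=> [p|p []].
have [f2i f2E] : pi.-integrable setT (EFin \o (f \o snd)) /\ \int[pi]_p f p.2 = \int[m]_x f x.
  apply: integral_image => //; last exact: (@qgrowth_integrable _ _ S).
  by move=> B mB; have [_ <-] := cpl _ mB; congr (pi _); apply/seteqP; split=> [p|p []].
have c_i : pi.-integrable setT (EFin \o (fun p : X * X => enorm (p.1 - p.2) ^+ 2)).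
  apply/integrableP; split; first exact/measurable_EFinP.
  under eq_integral do rewrite /= ger0_norm ?sqr_ge0//.
  exact: le_lt_trans cA (ltry _).
have {}cA : \int[pi]_p (enorm (p.1 - p.2) ^+ 2) <= A.
  by rewrite -lee_fin /Rintegral fineK//; exact: integrable_fin_num.
have t0 : 0 < Num.sqrt A by rewrite sqrtr_gt0.
set t := Num.sqrt A in t0 *.
have tA : t ^+ 2 = A by rewrite sqr_sqrtr ?ltW.
pose b := K / (2 * t).
have b0 : 0 <= b by rewrite divr_ge0// mulr_ge0// ltW.
have ki : pi.-integrable setT (EFin \o cst (K * t / 2)).
  exact: finite_measure_integrable_cst.
have bi : pi.-integrable setT (EFin \o (fun p : X * X => b * enorm (p.1 - p.2) ^+ 2)).
  by have := integrableZl measurableT b c_i; congr integrable; apply/funext.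
rewrite -f1E -f2E -(RintegralB measurableT f1i f2i).
apply: (@le_trans _ _ (\int[pi]_p (K * t / 2 + b * enorm (p.1 - p.2) ^+ 2))).
  apply: le_Rintegral => //.
  - by have := integrableB measurableT f1i f2i; congr integrable; apply/funext.
  - by have := integrableD measurableT ki bi; congr integrable; apply/funext.
  move=> p _; apply: le_trans (fK p.1 p.2 _ _) _; [by rewrite SE..|].
  have -> : K * t / 2 + b * enorm (p.1 - p.2) ^+ 2 =
      K * ((t + enorm (p.1 - p.2) ^+ 2 / t) / 2).
    by rewrite /b; field; rewrite gt_eqF.
  rewrite ler_wpM2l// -[leLHS]ger0_norm ?enorm_ge0//; apply: norm_le_amgm; first exact: ltW.
  - by rewrite divr_ge0 ?sqr_ge0// ltW.
  - by rewrite mulrC divfK// gt_eqF.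
rewrite (RintegralD measurableT ki bi) (RintegralZl _ measurableT c_i).
rewrite Rintegral_cst// [X in fine X]probability_setT mulr1.
rewrite -mulrA.
have -> : K * t = K * (t / 2) + b * A by rewrite -tA /b; field; rewrite gt_eqF.
by rewrite lerD2l ler_wpM2l.
Qed.

End DualBounds.

(** * Second differences and the mixed second derivative *)

Section MixedDerivative.
Context (R : realType) (dim : nat).
Local Notation X := 'rV[R]_dim.
Implicit Types (u v x y z w : X) (U : X * X -> R).

Lemma MVT01 (f df : R -> R) : (forall s, is_derive s (1:R) f (df s)) ->
  exists c, f 1 - f 0 = df c.
Proof.
move=> fd.
have fc : {within `[(0:R), 1], continuous f}.
  apply: continuous_subspaceT => s; apply: differentiable_continuous.
  by apply/derivable1_diffP; case: (fd s).
have [c _ ->] := MVT ltr01 (fun s _ => fd s) fc.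
by exists c; rewrite subr0 mulr1.
Qed.

Lemma is_derive_line (f : X -> R^o) w v (s : R) :
  derivable f (w + s *: v) v ->
  is_derive s (1:R) (fun s => f (w + s *: v) : R) ('D_v f (w + s *: v)).
Proof.
have E : (fun h : R => h^-1 *: (((fun s => f (w + s *: v)) \o shift s) (h *: (1:R)) - f (w + s *: v)))
   = (fun h : R => h^-1 *: ((f \o shift (w + s *: v)) (h *: v) - f (w + s *: v))).
  apply/funext => h /=; congr (_ *: (f _ - _)).
  by rewrite [h *: 1]mulr1 scalerDl addrCA.
move=> fd; split.
  by move: fd; rewrite /derivable E.
by rewrite /derive E.
Qed.

Lemma derive_grad (f : X -> R^o) a v : differentiable f a ->
  'D_v f a = \sum_j v 0 j * grad f a 0 j.
Proof.
move=> df; rewrite deriveE// {1}(row_sum_delta v) linear_sum.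
by apply: eq_bigr => j _; rewrite linearZ/= mxE deriveE.
Qed.

Lemma enorm_eq0 u : enorm u = 0 -> u = 0.
Proof.
move=> u0; apply/rowP => i; rewrite mxE; apply/eqP; rewrite -sqrf_eq0.
have /eqP : enorm u ^+ 2 = 0 by rewrite u0 expr0n.
rewrite sqr_enorm psumr_eq0; last by move=> j _; exact: sqr_ge0.
by move=> /allP/(_ i); rewrite mem_index_enum => /(_ isT).
Qed.

Lemma sum_mul_le_enorm u v : \sum_j u 0 j * v 0 j <= enorm u * enorm v.
Proof.
have [u0|u0] := eqVneq (enorm u) 0.
  by rewrite u0 mul0r (enorm_eq0 u0) big1// => j _; rewrite mxE mul0r.
have [v0|v0] := eqVneq (enorm v) 0.
  by rewrite v0 mulr0 (enorm_eq0 v0) big1// => j _; rewrite mxE mulr0.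
have ab : 0 < enorm u * enorm v by rewrite mulr_gt0// lt0r ?u0 ?v0 enorm_ge0.
have : 0 <= \sum_j (u 0 j * enorm v - v 0 j * enorm u) ^+ 2.
  by apply: sumr_ge0 => j _; exact: sqr_ge0.
have -> : \sum_j (u 0 j * enorm v - v 0 j * enorm u) ^+ 2 =
    2 * (enorm u * enorm v) * (enorm u * enorm v - \sum_j u 0 j * v 0 j).
  transitivity (\sum_j (u 0 j ^+ 2 * enorm v ^+ 2 + v 0 j ^+ 2 * enorm u ^+ 2 -
      2 * (enorm u * enorm v) * (u 0 j * v 0 j))).
    by apply: eq_bigr => j _; ring.
  by rewrite sumrB big_split/= -!mulr_suml -!sqr_enorm -mulr_sumr; ring.
by rewrite pmulr_rge0 ?subr_ge0// mulr_gt0.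
Qed.

Lemma enorm_mulmx_le (A : 'M[R]_dim) (L : R) u :
  (opnorm A <= L%:E)%E -> enorm (u *m A) <= L * enorm u.
Proof.
have sE (c : R) v : 0 <= c -> enorm (c *: v) = c * enorm v.
  move=> c0; rewrite /enorm -[in RHS](ger0_norm c0) -sqrtr_sqr -sqrtrM ?sqr_ge0// mulr_sumr.
  by congr Num.sqrt; apply: eq_bigr => i _; rewrite mxE exprMn.
move=> AL; have [u0|u0] := eqVneq (enorm u) 0.
  rewrite u0 mulr0.
  rewrite (enorm_eq0 u0).
  by rewrite mul0mx /enorm big1 ?sqrtr0// => i _; rewrite mxE expr0n.
have u_gt0 : 0 < enorm u by rewrite lt0r u0 enorm_ge0.
have : (enorm (((enorm u)^-1 *: u) *m A))%:E \in [set (enorm (v *m A))%:E | v in [set v : X | enorm v <= 1]].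
  rewrite inE; exists ((enorm u)^-1 *: u) => //=.
  by rewrite sE ?invr_ge0 ?enorm_ge0// mulVf.
rewrite inE => /ereal_sup_ubound /le_trans/(_ AL).
by rewrite lee_fin -scalemxAl sE ?invr_ge0 ?enorm_ge0// ler_pdivrMl// mulrC.
Qed.

(** Two applications of the mean value theorem, in the order of differentiation of [hess12]: first
    along [w, z] to U(x, .) - U(y, .), then along [y, x] to the derivative in direction v at the
    intermediate point b. The second difference becomes exactly u H v^T for one value H of
    [hess12]. *)
Lemma hess12_le U (L : R) : 0 <= L -> has_hess12 U -> (norm_hess12 U <= L%:E)%E ->
  forall x y z w,
  U (x, z) - U (x, w) - U (y, z) + U (y, w) <= L * enorm (x - y) * enorm (z - w).
Proof.
move=> L0 hU UL x y z w; pose u := x - y; pose v := z - w.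
pose U1 (a : X) (b : X) : R^o := U (a, b).
have d1 a b : differentiable (U1 a) b by case: (hU a b).
have line a : forall s : R, is_derive s (1:R) (fun s => U1 a (w + s *: v) : R)
   ('D_v (U1 a) (w + s *: v)).
  by move=> s; apply: is_derive_line; exact: diff_derivable.
have [c Ec] := @MVT01 (fun s => U1 x (w + s *: v) - U1 y (w + s *: v))
  (fun s => 'D_v (U1 x) (w + s *: v) - 'D_v (U1 y) (w + s *: v))
  (fun s => is_deriveB (line x s) (line y s)).
set b := w + c *: v in Ec.
pose f j (a : X) : R^o := grad2 U a b 0 j.
have fd j a : differentiable (f j) a.
  have [_ h] := hU a b.
  have -> : f j = (fun N : X => N 0 j : R^o) \o (fun x' => grad2 U x' b) by [].
  by apply: differentiable_comp => //; exact: differentiable_coord.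
have sd (s : R) : is_derive s (1:R) (fun s => \sum_j v 0 j * f j (y + s *: u) : R)
    (\sum_j v 0 j * 'D_u (f j) (y + s *: u)).
  have dj j : is_derive s (1:R) (fun s => v 0 j * f j (y + s *: u) : R)
      (v 0 j * 'D_u (f j) (y + s *: u)).
    exact: is_deriveZ (is_derive_line (diff_derivable (fd j _))).
  have := is_derive_sum dj; congr (is_derive _ _ _ _).
  by apply/funext => t; rewrite fct_sumE.
have [c' Ec'] := MVT01 sd.
set a := y + c' *: u in Ec'.
have Eh : U (x, z) - U (x, w) - U (y, z) + U (y, w) =
    \sum_j (u *m hess12 U a b) 0 j * v 0 j.
  transitivity (\sum_j v 0 j * 'D_u (f j) a); last first.
    apply: eq_bigr => j _; rewrite mulrC derive_grad//; congr (_ * _).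
    by rewrite mxE; apply: eq_bigr => i _; rewrite !mxE.
  have Ez : w + 1 *: v = z by rewrite scale1r /v addrC subrK.
  have Ew : w + 0 *: v = w by rewrite scale0r addr0.
  have Ex : y + 1 *: u = x by rewrite scale1r /u addrC subrK.
  have Ey : y + 0 *: u = y by rewrite scale0r addr0.
  rewrite -Ec' Ex Ey; move: Ec; rewrite /= Ez Ew !derive_grad// => Ec.
  by rewrite -[RHS]Ec /U1; ring.
rewrite Eh; apply: le_trans (sum_mul_le_enorm _ _) _.
rewrite ler_wpM2r ?enorm_ge0//; apply: enorm_mulmx_le; apply: le_trans UL.
by apply: ereal_sup_ubound; exists (a, b).
Qed.

End MixedDerivative.

Section KernelBounds.
Context (R : realType) (dim : nat).
Local Notation X := 'rV[R]_dim.
Implicit Types (m nu xi : probability X R) (U : X * X -> R).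

Definition diff2 U (x y z w : X) := U (x, z) - U (x, w) - U (y, z) + U (y, w).

Lemma Osc2_le U A : (Osc2 U <= A%:E)%E -> forall x y z w, diff2 U x y z w <= A.
Proof.
move=> UA x y z w; rewrite -lee_fin; apply: le_trans UA.
by apply: ereal_sup_ubound; exists x, y, z, w.
Qed.

Lemma Osc2_ge0 U : (0 <= Osc2 U)%E.
Proof.
apply: ereal_sup_ubound; exists 0, 0, 0, 0.
by rewrite subrr sub0r addNr.
Qed.

Lemma enorm0 : enorm (0 : X) = 0.
Proof. by rewrite /enorm big1 ?sqrtr0// => i _; rewrite mxE expr0n. Qed.

Lemma enormN (x : X) : enorm (- x) = enorm x.
Proof. by congr Num.sqrt; apply: eq_bigr => i _; rewrite mxE sqrrN. Qed.

Lemma norm_hess12_ge0 U : (0 <= norm_hess12 U)%E.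
Proof.
apply: (@le_trans _ _ (opnorm (hess12 U 0 0))).
  by apply: ereal_sup_ubound; exists 0; rewrite /= ?enorm0 ?ler01// mul0mx enorm0.
by apply: ereal_sup_ubound; exists (0, 0).
Qed.

(** Here the transport cost is half the L^1 distance, whose square Pinsker bounds by H / 2. With A =
    4 M_W this gives 2 M_W H. *)
Lemma bracket_diff_osc S xi m U A H : P2 S xi -> P2 S m -> qkernel S U ->
  0 <= A -> (forall x y z w, diff2 U x y z w <= A) ->
  rel_entropy xi m = H%:E -> bracket_diff U xi m <= A * H / 2.
Proof.
move=> hxi hm qU A0 UA HE.
have [|h hd] := @rel_entropy_lty_density _ _ xi m; first by rewrite HE ltry.
have T := pinsker hd HE.
apply: le_trans (bracket_diff_transport hxi hm qU A0 _ _ (transport_bound_tv hxi hm hd) _) _ => //.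
- by rewrite divr_ge0// Rintegral_ge0.
- by move=> x y z w; rewrite !mulr1; exact: UA.
- by rewrite exprMn -mulrA ler_wpM2l// expr2; nra.
Qed.

(** A near-optimal coupling stands in for an optimal one. The slack e also keeps the cost bound
    positive, as [transport_bound_coupling] requires, even when H = 0. *)
Lemma Talagrand_coupling rho m xi H e : Talagrand Euclid rho m -> P2 Euclid xi ->
  0 < rho -> rel_entropy xi m = H%:E -> 0 < e ->
  exists pi, is_coupling xi m pi /\
    (\int[pi]_p (enorm (p.1 - p.2) ^+ 2)%:E <= (2 * H / rho + e)%:E)%E.
Proof.
move=> T hxi rho0 HE e0; have := T xi hxi; rewrite HE => TH.
have : (W2sq Euclid xi m < (2 * H / rho + e)%:E)%E.
  have r2 : 0 < rho / 2 by rewrite divr_gt0.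
  have W0 : (0 <= W2sq Euclid xi m)%E.
    by apply: le_ereal_inf_tmp => _ [pi _ <-]; apply: integral_ge0 => p _; rewrite lee_fin sqr_ge0.
  move: W0 TH; case: (W2sq _ _ _) => [r| |] //=.
    rewrite -EFinM !lee_fin lte_fin => r0 rH.
    have : r <= 2 * H / rho by rewrite ler_pdivlMr//; lra.
    by lra.
  by rewrite gt0_muley// lte_fin.
by move=> /ereal_inf_lt[_ [pi cpl <-] lt]; exists pi; split => //; exact: ltW.
Qed.

Lemma bracket_diff_hess rho xi m U L H : P2 Euclid xi -> P2 Euclid m ->
  Talagrand Euclid rho m -> 0 < rho -> qkernel Euclid U -> 0 <= L ->
  (forall x y z w, diff2 U x y z w <= L * enorm (x - y) * enorm (z - w)) ->
  rel_entropy xi m = H%:E -> bracket_diff U xi m <= L * (2 * H / rho).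
Proof.
move=> hxi hm T rho0 qU L0 UL HE.
have H0 : 0 <= H by rewrite -lee_fin -HE rel_entropy_ge0.
(* This makes L e' <= e; the 1 in the denominator covers L = 0. *)
apply/ler_addgt0Pr => e e0; pose e' := e / (L + 1).
have L1 : 0 < L + 1 by rewrite ltr_wpDl.
have e'0 : 0 < e' by rewrite divr_gt0.
have [pi [cpl cA]] := Talagrand_coupling T hxi rho0 HE e'0.
have A0 : 0 < 2 * H / rho + e' by rewrite ltr_wpDl// divr_ge0 ?mulr_ge0// ltW.
have tb := transport_bound_coupling erefl hxi hm cpl A0 cA.
apply: le_trans (bracket_diff_transport hxi hm qU L0 (sqrtr_ge0 _) _ tb UL) _.
  by move=> x y; exact: enorm_ge0.
rewrite sqr_sqrtr; last exact: ltW.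
rewrite mulrDr lerD2l /e' mulrA ler_pdivrMr// mulrC ler_wpM2l//; first exact: ltW.
by rewrite lerDl.
Qed.

(* [Osc2] and [hess12] control a kernel only up to functions of one variable, so
   that W_b and W_q may fail to be integrable; their based versions are, and
   [bracket_diff] does not see the difference. *)
Definition based U (p : X * X) := U p - U (p.1, 0) - U (0, p.2) + U (0, 0).

Lemma basedE U x y : based U (x, y) = diff2 U x 0 y 0.
Proof. by []. Qed.

Lemma diff2_based U x y z w : diff2 (based U) x y z w = diff2 U x y z w.
Proof. by rewrite /diff2 /based /=; ring. Qed.

Lemma measurable_based U : measurable_fun setT U -> measurable_fun setT (based U).
Proof.
move=> mU.
have m1 : measurable_fun [set: X * X] (fun p => U (p.1, 0)).
  exact: (measurableT_comp mU (measurable_fun_pair measurable_fst (measurable_cst _))).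
have m2 : measurable_fun [set: X * X] (fun p => U (0, p.2)).
  exact: (measurableT_comp mU (measurable_fun_pair (measurable_cst _) measurable_snd)).
apply: measurable_funD => //.
exact: (measurable_funB (measurable_funB mU m1) m2).
Qed.

Lemma diff2_swap U x y z w : diff2 U y x z w = - diff2 U x y z w.
Proof. by rewrite /diff2; ring. Qed.

Lemma qkernel_based_osc S U A : measurable_fun setT U ->
  (forall x y z w, diff2 U x y z w <= A) -> qkernel S (based U).
Proof.
move=> mU UA; split; first exact: measurable_based.
have A0 : 0 <= A by apply: le_trans (UA 0 0 0 0); rewrite /diff2; lra.
exists A => x y _ _; rewrite basedE; apply: (@le_trans _ _ A).
  by rewrite ler_norml lerNl -diff2_swap !UA.
by rewrite ler_peMr// -addrA lerDl addr_ge0 ?sqr_ge0.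
Qed.

Lemma qkernel_based_hess S U L : measurable_fun setT U -> 0 <= L ->
  (forall x y z w, diff2 U x y z w <= L * enorm (x - y) * enorm (z - w)) ->
  qkernel S (based U).
Proof.
move=> mU L0 UL; split; first exact: measurable_based.
exists L => x y _ _; rewrite basedE; apply: (@le_trans _ _ (L * enorm x * enorm y)).
  rewrite ler_norml lerNl -diff2_swap.
  have := UL x 0 y 0; have := UL 0 x y 0.
  by rewrite !(subr0, sub0r) enormN => -> ->.
rewrite -mulrA ler_wpM2l//; have := enorm_ge0 x; have := enorm_ge0 y.
by move: (enorm x) (enorm y) => a b; have := sqr_ge0 (a - b); nra.
Qed.

Lemma bracket_diff_based S xi m U : P2 S xi -> P2 S m -> qkernel S U ->
  bracket_diff (based U) xi m = bracket_diff U xi m.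
Proof.
move=> hxi hm qU.
have c0 : carrier S (0 : X) by case: (S) => //= i; rewrite mxE lexx ltr01.
have q1 := qkernel_section (qkernel_swap qU) c0; have q2 := qkernel_section qU c0.
have E mu nu : P2 S mu -> P2 S nu -> bracket (based U) mu nu =
    bracket U mu nu - \int[mu]_x U (x, 0) - \int[nu]_y U (0, y) + U (0, 0).
  by move=> hmu hnu; exact: (bracket_sub12 (U (0, 0)) hmu hnu qU q1 q2).
by rewrite /bracket_diff !E//; ring.
Qed.

Lemma bracket_diffD S xi m U U' : P2 S xi -> P2 S m -> qkernel S U -> qkernel S U' ->
  bracket_diff (fun p => U p + U' p) xi m = bracket_diff U xi m + bracket_diff U' xi m.
Proof.
by move=> hxi hm qU qU'; rewrite /bracket_diff !(@bracketD _ _ S)//; ring.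
Qed.

(** Puts the torus and R^d in one form for the rest of the proof. The factor 2 adds the oscillation
    bound 4 M_W H / 2 and the transport bound L_W (2 H / rho). Only W^+ receives a quantitative
    bound; W^- enters through positivity. *)
Lemma decomposable_split S (MW LW rho : R) W m : decomposable S MW LW W ->
  0 <= MW -> 0 <= LW -> 0 < rho -> P2 S m -> Talagrand S rho m ->
  exists Wp Wm : X * X -> R,
    [/\ forall p, W p = Wp p - Wm p,
        [/\ qkernel S Wp, symmetric_kernel Wp & positive_kernel S Wp],
        [/\ qkernel S Wm, symmetric_kernel Wm & positive_kernel S Wm] &
        forall xi H, P2 S xi -> rel_entropy xi m = H%:E ->
          bracket_diff Wp xi m <= 2 * (MW + LW / rho) * H].
Proof.
move=> [Wp [Wm [WE [kp gp sp pp] [km gm sm pm] dec]]] MW0 LW0 rho0 hm T.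
have qp : qkernel S Wp by split => //; case: kp.
have qm : qkernel S Wm by split => //; case: km.
exists Wp, Wm; split => // xi H hxi HE.
have H0 : 0 <= H by rewrite -lee_fin -HE rel_entropy_ge0.
case: S dec kp gp pp km gm pm qp qm hm T hxi => dec kp gp pp km gm pm qp qm hm T hxi.
  have [WO ->] := dec.
  have WpO : (Osc2 Wp <= (4 * MW)%:E)%E by rewrite (le_trans _ WO)// leeDl// Osc2_ge0.
  have := bracket_diff_osc hxi hm qp (mulr_ge0 (ler0n _ 4) MW0) (Osc2_le WpO) HE.
  by rewrite mul0r addr0; lra.
have [Wpb [Wpq [Wmb [Wmq [Epb _ [[mb _ _] [mq _ _] _ _] _ [WO hq _ Wh]]]]]] := dec.
have WpO : (Osc2 Wpb <= (4 * MW)%:E)%E by rewrite (le_trans _ WO)// leeDl// Osc2_ge0.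
have Wqh : (norm_hess12 Wpq <= LW%:E)%E by rewrite (le_trans _ Wh)// leeDl// norm_hess12_ge0.
have bO := Osc2_le WpO; have qh := hess12_le LW0 hq Wqh.
have kb := qkernel_based_osc Euclid mb bO.
have kq := qkernel_based_hess Euclid mq LW0 qh.
rewrite -(bracket_diff_based hxi hm qp).
have -> : based Wp = (fun p => based Wpb p + based Wpq p).
  by apply/funext => p; rewrite /based !Epb; ring.
rewrite (bracket_diffD hxi hm kb kq).
have bO' x y z w : diff2 (based Wpb) x y z w <= 4 * MW by rewrite diff2_based; exact: bO.
have qh' x y z w : diff2 (based Wpq) x y z w <= LW * enorm (x - y) * enorm (z - w).
  by rewrite diff2_based; exact: qh.
have h1 := bracket_diff_osc hxi hm kb (mulr_ge0 (ler0n _ 4) MW0) bO' HE.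
have h2 := bracket_diff_hess hxi hm T rho0 kq LW0 qh' HE.
apply: le_trans (lerD h1 h2) _; rewrite le_eqVlt; apply/orP; left; apply/eqP.
by field; rewrite gt_eqF.
Qed.

End KernelBounds.

(** * Mixtures and Gibbs measures *)

Section BorelRV.
Context (R : realType) (dim : nat).
Local Notation X := 'rV[R]_dim.

(** The sigma-algebra is generated by the coordinates, so an open set is covered by the countably
    many rational boxes that it contains. It is needed for the measurability of V. *)
Lemma open_measurable_rv (A : set X) : open A -> measurable A.
Proof.
move=> oA; pose B (p : 'rV[rat]_dim * nat) : set X :=
  [set y | forall i, `|y 0 i - ratr (p.1 0 i)| < p.2.+1%:R^-1].
have mB p : measurable (B p).
  rewrite (_ : B p = \bigcap_(i in [set: 'I_dim]) (rv_coord i @^-1`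
      (ball (ratr (p.1 0 i) : R) p.2.+1%:R^-1))).
    apply: fin_bigcap_measurable => // i _; rewrite -[X in measurable X]setTI.
    by apply: measurable_rv_coord => //; exact: measurable_ball.
  by apply/seteqP; split => y By i; have := By i; rewrite /ball/= distrC => h; [move=> _|]; exact: h.
rewrite (_ : A = \bigcup_p (if `[< B p `<=` A >] then B p else set0)); last first.
  apply/seteqP; split => [x Ax|x [p _]]; last by case: asboolP => // BA; exact: BA.
  have /nbhs_ballP[e /= e0 xeA] : nbhs x A by exact: open_nbhs_nbhs.
  have [n ne] : exists n, n.+1%:R^-1 < e / 2.
    have : 0 < e / 2 by rewrite divr_gt0.
    by move=> /ltr_add_invr[k]; rewrite add0r; exists k.
  have /choice[q hq] : forall i : 'I_dim, exists q : rat,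
      ratr q \in `]x 0 i - n.+1%:R^-1, x 0 i + n.+1%:R^-1[.
    move=> i; apply: rat_in_itvoo.
    by rewrite ltrD2l (@lt_trans _ _ 0)// ?oppr_lt0 invr_gt0.
  exists (\row_i q i, n) => //; case: asboolP => [_ i|[]].
    by rewrite /= mxE ltr_distlC; have := hq i; rewrite in_itv.
  move=> y By; apply: xeA; split => // i j.
  rewrite (ord1 i); have := By j; rewrite /= mxE; have := hq j; rewrite in_itv/=.
  rewrite /ball/= !ltr_distlC => /andP[h1 h2] /andP[h3 h4].
  move: (n.+1%:R^-1) (ratr (q j)) (x 0 j) (y 0 j) ne h1 h2 h3 h4 => r s x_ y_ ne h1 h2 h3 h4.
  apply/andP; split; lra.
apply: countable_bigcupT_measurable; first exact: countableP.
by move=> p; case: asboolP.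
Qed.

Lemma continuous_measurable_rv (f : X -> R) : continuous f -> measurable_fun setT f.
Proof.
move=> cf; apply: (measurability _ (RGenOInfty.measurableE R)) => _ [_ [a ->] <-].
rewrite setTI; apply: open_measurable_rv; exact: open_comp.
Qed.

End BorelRV.

Section Mixture.
Context (R : realType) (dim n : nat).
Local Notation X := 'rV[R]_dim.
Variables (P : pred 'I_n) (c : R) (nu : probability X R) (xi : 'I_n -> probability X R).
Hypothesis c0 : 0 <= c.
Hypothesis nuE : forall A, measurable A ->
  (nu A = c%:E * \sum_(j < n | P j) xi j A)%E.

Lemma mixture_weight : c * \sum_(j < n | P j) 1 = 1.
Proof.
have := nuE measurableT; rewrite [LHS]probability_setT.
rewrite (eq_bigr (fun=> 1%E)); last by move=> j _; exact: probability_setT.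
by rewrite sumEFin -EFinM => -[] /esym.
Qed.

Lemma ge0_integral_mixture (f : X -> \bar R) : measurable_fun setT f ->
  (forall x, 0 <= f x)%E ->
  (\int[nu]_x f x = c%:E * \sum_(j < n | P j) \int[xi j]_x f x)%E.
Proof.
(* [msum] adds a sequence of measures indexed by [nat], hence the [insub]; indices out of range or
   excluded by [P] carry the zero measure. *)
move=> mf f0; pose m_ (k : nat) : {measure set X -> \bar R} :=
  if insub k is Some j then
    if P j then [the {measure set X -> \bar R} of mscale (NngNum c0) (xi j)]
    else [the {measure set X -> \bar R} of mzero]
  else [the {measure set X -> \bar R} of mzero].
have mE (j : 'I_n) : m_ j = if P j
    then [the {measure set X -> \bar R} of mscale (NngNum c0) (xi j)]
    else [the {measure set X -> \bar R} of mzero].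
  by rewrite /m_ valK.
transitivity (\int[msum m_ n]_x f x)%E.
  apply: eq_measure_integral => A mA _; rewrite [LHS](nuE mA) /msum/= big_mkcond/=.
  rewrite ge0_sume_distrr; last by move=> j _; case: ifP.
  by apply: eq_bigr => j _; rewrite mE; case: ifP; rewrite ?mule0.
rewrite ge0_integral_measure_sum// [in RHS]big_mkcond/= ge0_sume_distrr; last first.
  by move=> j _; case: ifP => // _; exact: integral_ge0.
apply: eq_bigr => j _; rewrite mE; case: ifP => _.
  by rewrite ge0_integral_mscale.
by rewrite integral_measure_zero mule0.
Qed.

Variable S : ambient.
Hypothesis hxi : forall j, P2 S (xi j).

Lemma mixture_P2 : P2 S nu.
Proof.
case: S hxi => h; rewrite /P2.
  have mc := @measurable_carrier R dim Torus.
  rewrite (nuE mc) (eq_bigr (fun=> 1%E)); last by move=> j _; exact: h.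
  by rewrite sumEFin -EFinM mixture_weight.
rewrite ge0_integral_mixture; last 2 first.
- by apply/measurable_EFinP; exact: measurable_sqr_enorm.
- by move=> x; rewrite lee_fin sqr_ge0.
apply: lte_mul_pinfty; rewrite ?lee_fin//.
by apply: lte_sum_pinfty => j _; exact: h.
Qed.

Lemma Rintegral_mixture (f : X -> R) : qgrowth S f ->
  \int[nu]_x f x = c * \sum_(j < n | P j) \int[xi j]_x f x.
Proof.
move=> qf.
have ge0 g : qgrowth S g -> (forall x, 0 <= g x) ->
    \int[nu]_x g x = c * \sum_(j < n | P j) \int[xi j]_x g x.
  move=> qg g0; have [mg _] := qg; rewrite /Rintegral ge0_integral_mixture.
  - rewrite (eq_bigr (fun j => (\int[xi j]_x g x)%:E)); last first.
      move=> j _; rewrite /Rintegral fineK//; apply: integrable_fin_num => //.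
      exact: (qgrowth_integrable (hxi j) qg).
    by rewrite sumEFin -EFinM.
  - exact/measurable_EFinP.
  - by move=> x; rewrite lee_fin.
have qa : qgrowth S (fun x => `|f x|).
  case: qf => mf [C hC]; split; first exact: measurableT_comp.
  by exists C => x cx; rewrite normr_id; exact: hC.
have qfa := qgrowthD qf qa.
(* A signed function is the difference of f + |f| and |f|, both nonnegative and of quadratic
   growth. *)
have E (mu : probability X R) : P2 S mu ->
    \int[mu]_x f x = \int[mu]_x (f x + `|f x|) - \int[mu]_x `|f x|.
  move=> hmu; rewrite RintegralD ?addrK//; exact: (@qgrowth_integrable _ _ S).
rewrite (E _ mixture_P2) (ge0 _ qfa) ?(ge0 _ qa)//; last first.
  by move=> x; rewrite -lerBlDl sub0r lerNl lerNnormlW.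
by rewrite -mulrBr -sumrB; congr (_ * _); apply: eq_bigr => j _; rewrite -E.
Qed.

Lemma bracket_mixture (U : X * X -> R) mu : P2 S mu -> qkernel S U ->
  bracket U nu mu = c * \sum_(j < n | P j) bracket U (xi j) mu.
Proof.
move=> hmu qU; rewrite (bracketE mixture_P2 hmu qU) Rintegral_mixture//; last exact: qgrowth_Rintegral.
by congr (_ * _); apply: eq_bigr => j _; rewrite (bracketE (hxi j) hmu qU).
Qed.

End Mixture.

Section GibbsDensity.
Context (R : realType) (dim : nat).
Local Notation X := 'rV[R]_dim.
Implicit Types (m nu xi pi : probability X R) (f g : X -> R).

Definition boltzmann S (a : R) f (x : X) : R := a * (expR (- f x) * \1_(carrier S) x).

Lemma has_density_gibbs S f : measurable_fun setT f ->
  has_density (gibbs_measure S f) (leb R dim) (boltzmann S 1 f).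
Proof.
move=> mf; have me : measurable_fun setT (fun x => expR (- f x)).
  by apply: measurableT_comp => //; exact: measurableT_comp.
split => [|x|A mA].
- apply: measurable_funM => //; apply: measurable_funM => //.
  by apply: measurable_indic; exact: measurable_carrier.
- by rewrite /boltzmann mul1r mulr_ge0// expR_ge0.
- rewrite /= /gibbs_measure asboolT// setIC integral_mkcondr.
  apply: eq_integral => x _; rewrite /boltzmann mul1r patchE indicE.
  by case: ifPn => _; rewrite ?mulr1 ?mulr0.
Qed.

Lemma has_densityZ (mu nu nu' : {measure set X -> \bar R}) w a : 0 <= a ->
  has_density nu mu w -> (forall A, measurable A -> nu' A = nu A * a%:E)%E ->
  has_density nu' mu (fun x => a * w x).
Proof.
move=> a0 [mw w0 nuE] E; split => [|x|A mA].
- exact: measurable_funM.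
- exact: mulr_ge0.
- rewrite E// nuE// muleC -ge0_integralZl//; last by move=> x _; rewrite lee_fin.
  exact/measurable_funTS/measurable_EFinP.
Qed.

Lemma has_density_Pi S (V : X -> R) W (nu : {measure set X -> \bar R}) :
  measurable_fun setT (gibbs_potential V W nu) ->
  (0 < \int[leb R dim]_(x in carrier S) (expR (- gibbs_potential V W nu x))%:E
    < +oo)%E ->
  exists a : R, 0 < a /\ has_density (Pi_map S V W nu) (leb R dim)
    (boltzmann S a (gibbs_potential V W nu)).
Proof.
move=> mf /andP[Z0 Zy]; set f := gibbs_potential V W nu in mf Z0 Zy *.
set Z := (\int[leb R dim]_(x in carrier S) _)%E in Z0 Zy.
have ZE : gibbs_measure S f setT = Z by rewrite /gibbs_measure asboolT// setIT.
have Zf : 0 < fine Z by rewrite fine_gt0// Z0.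
exists (fine Z)^-1; split; first by rewrite invr_gt0.
have -> : boltzmann S (fine Z)^-1 f = (fun x => (fine Z)^-1 * boltzmann S 1 f x).
  by apply/funext => x; rewrite /boltzmann mul1r.
apply: (has_densityZ _ (has_density_gibbs S mf)); first by rewrite invr_ge0 ltW.
move=> A mA; rewrite /Pi_map /= /mnormalize -/f.
rewrite [X in (X == 0%E) || _]ZE [X in _ || (X == _)]ZE gt_eqF//= lt_eqF//=.
by congr (_ * (fine _)^-1%:E)%E; exact: ZE.
Qed.

(** The indicator of the carrier is dropped from the quotient: both measures vanish off the carrier.
    When b > 0 the density is then positive at every point, as [rel_entropy_change] requires. *)
Lemma has_density_quotient S m pi (mu : {measure set X -> \bar R}) a b f g :
  0 < a -> 0 <= b -> measurable_fun setT f -> measurable_fun setT g ->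
  has_density m mu (boltzmann S a f) -> has_density pi mu (boltzmann S b g) ->
  has_density pi m (fun x => b / a * expR (f x - g x)).
Proof.
move=> a0 b0 mf mg md [mw w0 piE].
have me : measurable_fun setT (fun x => b / a * expR (f x - g x)).
  by apply: measurable_funM => //; apply: measurableT_comp => //; exact: measurable_funB.
have e0 x : 0 <= b / a * expR (f x - g x).
  by rewrite mulr_ge0 ?expR_ge0// divr_ge0// ltW.
split => // A mA; rewrite [RHS]integral_mkcond (integral_density md).
- rewrite piE// integral_mkcond; apply: eq_integral => x _; rewrite !patchE.
  case: ifPn => _; last by rewrite mul0e.
  rewrite -EFinM /boltzmann; congr EFin.
  rewrite expRD; have : expR (f x) * expR (- f x) = 1 by rewrite expRN mulfV// gt_eqF// expR_gt0.
  move: (expR (f x)) (expR (- f x)) (expR (- g x)) (\1_(carrier S) x) => p q r s pq.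
  have -> : b / a * (p * r) * (a * (q * s)) = b * (r * s) * (p * q) * (a / a) by ring.
  by rewrite pq divff ?gt_eqF// !mulr1.
- apply/measurable_restrict => //; rewrite setTI.
  exact/measurable_funTS/measurable_EFinP.
- by move=> x; rewrite patchE; case: ifPn => // _; rewrite lee_fin.
Qed.

Lemma measurable_gibbs_potential (V : X -> R) W nu : continuous V ->
  measurable_fun setT W -> measurable_fun setT (gibbs_potential V W nu).
Proof.
move=> cV mW; apply: measurable_funD; first exact: continuous_measurable_rv.
exact: measurable_Rintegral_section.
Qed.

(** The fixed-point property makes [m] a Gibbs measure too, so V, whose growth is arbitrary, cancels
    in the density of Pi[nu] with respect to [m]; the logarithm left over has quadratic growth.
    [kappa] is the logarithm of the ratio of the two partition functions. *)
Lemma rel_entropy_Pi S (V : X -> R) W m nu : continuous V -> qkernel S W ->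
  normalizable S V W -> P2 S m ->
  (forall A, measurable A -> m A = Pi_map S V W m A) -> P2 S nu ->
  exists kappa : R, forall xi, P2 S xi ->
    rel_entropy xi (Pi_map S V W nu) =
    (rel_entropy xi m + (kappa + bracket W xi nu - bracket W xi m)%:E)%E.
Proof.
move=> cV qW hN hm mE hnu; have [mW _] := qW.
have mfm := measurable_gibbs_potential m cV mW.
have mfn := measurable_gibbs_potential nu cV mW.
have [a [a0 [mwa wa0 aE]]] := has_density_Pi mfm (hN m hm).
have [b [b0 bd]] := has_density_Pi mfn (hN nu hnu).
have ad : has_density m (leb R dim) (boltzmann S a (gibbs_potential V W m)).
  by split => // A mA; rewrite [LHS](mE _ mA) [LHS](aE _ mA).
have gd := has_density_quotient a0 (ltW b0) mfm mfn ad bd.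
exists (- ln (b / a)) => xi hxi.
have ba : 0 < b / a by rewrite divr_gt0.
have g0 x : 0 < b / a * expR (gibbs_potential V W m x - gibbs_potential V W nu x).
  by rewrite mulr_gt0// expR_gt0.
have qm := qgrowth_Rintegral hm qW; have qn := qgrowth_Rintegral hnu qW.
have lgE x : ln (b / a * expR (gibbs_potential V W m x - gibbs_potential V W nu x)) =
    ln (b / a) + (\int[m]_y W (x, y) - \int[nu]_y W (x, y)).
  rewrite lnM ?posrE ?expR_gt0// expRK /gibbs_potential.
  by ring.
have ql := qgrowthD (@qgrowth_cst R dim S (ln (b / a))) (qgrowthB qm qn).
have li := qgrowth_integrable hxi ql.
rewrite (rel_entropy_change gd g0); last first.
  by have := li; congr integrable; apply/funext => x /=; rewrite lgE.
congr (_ + _)%E.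
have -> : (\int[xi]_x (ln (b / a * expR (gibbs_potential V W m x - gibbs_potential V W nu x)))%:E =
    (\int[xi]_x (ln (b / a) + (\int[m]_y W (x, y) - \int[nu]_y W (x, y))))%R%:E)%E.
  rewrite /Rintegral fineK; last exact: integrable_fin_num li.
  by apply: eq_integral => x _; rewrite lgE.
rewrite -EFinN; congr EFin.
have i1 := qgrowth_integrable hxi (@qgrowth_cst R dim S (ln (b / a))).
have i2 := qgrowth_integrable hxi (qgrowthB qm qn).
have im := qgrowth_integrable hxi qm; have i_n := qgrowth_integrable hxi qn.
rewrite (RintegralD measurableT i1 i2) (RintegralB measurableT im i_n).
by rewrite Rintegral_prob_cst (bracketE hxi hnu qW) (bracketE hxi hm qW); ring.
Qed.

End GibbsDensity.

Section MeanProbability.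
Context (R : realType) (dim N : nat).
Local Notation X := 'rV[R]_dim.
Variables (xi : 'I_N -> probability X R) (i : 'I_N).

(** [others_mean] is only typed as a measure. Its mass is 1 when N > 1, so normalizing changes no
    value and the default [xi i] is never reached. *)
Definition mean_prob : probability X R := mnormalize (others_mean xi i) (xi i).

Lemma mean_probE : (1 < N)%N -> forall A, measurable A ->
  (mean_prob A = (N%:R - 1)^-1%:E * \sum_(j < N | j != i) xi j A)%E.
Proof.
move=> N1 A mA; have NE : (N%:R - 1 : R) = N.-1%:R.
  by rewrite -[in LHS](prednK (ltnW N1)) -natr1 addrK.
have N0 : (N%:R - 1 : R) != 0.
  by rewrite NE pnatr_eq0 -lt0n -ltnS (prednK (ltnW N1)).
have E1 : others_mean xi i setT = 1%E.
  rewrite /others_mean (eq_bigr (fun=> 1%E)); last by move=> j _; exact: probability_setT.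
  rewrite sumEFin -EFinM sumr_const (eq_card (B := predC1 i)) ?cardC1 ?card_ord -?NE ?mulVf//.
rewrite /mean_prob /= /mnormalize [X in (X == 0%E) || _]E1 [X in _ || (X == _)]E1.
by rewrite onee_eq0/= [X in fine X]E1 invr1 mule1.
Qed.

Lemma Pi_map_mean S (V : X -> R) W : (1 < N)%N ->
  Pi_map S V W (others_mean xi i) = Pi_map S V W mean_prob.
Proof.
move=> N1.
have E : gibbs_potential V W (others_mean xi i) = gibbs_potential V W mean_prob.
  apply/funext => x; congr (_ + fine _); apply: eq_measure_integral => A mA _.
  by rewrite [RHS](mean_probE N1 mA).
by rewrite /Pi_map E.
Qed.

End MeanProbability.

(** * Summation over the particles *)

Section FinalAlgebra.
Context (R : realFieldType) (N : nat).
Implicit Types (h e : 'I_N -> R) (B : 'I_N -> 'I_N -> R).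

Lemma sum_neq h i : \sum_(j < N | j != i) h j = \sum_j h j - h i.
Proof. by rewrite [in RHS](bigD1 i)//= addrAC subrr add0r. Qed.

Lemma sum_sum_neq B :
  \sum_i \sum_(j < N | i != j) B i j = \sum_i \sum_j B i j - \sum_i B i i.
Proof.
rewrite -sumrB; apply: eq_bigr => i _; rewrite -sum_neq.
by apply: eq_bigl => j; rewrite eq_sym.
Qed.

(** A pair (j, k) is counted once for each i different from both: N - 2 times off the diagonal and N
    - 1 times on it. *)
Lemma sum_sum_neq2 B : \sum_i \sum_(j < N | j != i) \sum_(k < N | k != i) B j k =
  (N%:R - 2) * \sum_i \sum_j B i j + \sum_i B i i.
Proof.
transitivity (\sum_(i < N) (\sum_j \sum_k B j k - \sum_j B i j - (\sum_j B j i - B i i))).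
  apply: eq_bigr => i _; rewrite sum_neq sum_neq.
  under eq_bigr do rewrite sum_neq.
  by rewrite sumrB; ring.
rewrite !sumrB sumr_const card_ord [X in _ - X - _]exchange_big/=.
rewrite [X in _ - (X - _)]exchange_big [X in _ - X - _]exchange_big/=.
by rewrite -mulr_natl; ring.
Qed.

(* [h i], [Bp i j - Bm i j] and [e i] stand for H(xi^i | m), <W_m, xi^i (x) xi^j>
   and H(xi^i | Pi[nu_i]), and k for M_W + L_W / rho. *)
Lemma entropy_sum_lower_bound (k delta : R) h e Bp Bm :
  (1 < N)%N -> 0 <= k -> 0 < delta -> delta <= 1 ->
  let n := N%:R - 1 in let B i j := Bp i j - Bm i j in
  1 + k < n * delta ->
  (forall i, 0 <= h i) ->
  (forall i, Bp i i <= 2 * k * h i) -> 0 <= \sum_i \sum_j Bp i j ->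
  (forall i, 0 <= Bm i i) ->
  (forall i j, 0 <= Bm i i + Bm j j - 2 * Bm i j) ->
  - ((1 - delta) * N%:R * \sum_i h i) <= 2^-1 * \sum_i \sum_j B i j ->
  (forall i, h i - (1 - delta) * (n^-1 * \sum_(j < N | j != i) h j)
    + n^-1 * \sum_(j < N | j != i) B j i
    - (1 - delta / 2) *
      (n^-1 * \sum_(j < N | j != i) (n^-1 * \sum_(k < N | k != i) B j k)) <= e i) ->
  (delta - 2 * (1 + k) / (n * delta - 1 - k)) *
    (\sum_i h i + (2 * n)^-1 * \sum_i \sum_(j < N | i != j) B i j) <= \sum_i e i.
Proof.
move=> N1 k0 d0 d1 n B nd h0 hBp Tp0 Bm0 hBm hT he.
have N2 : 2 <= N%:R :> R by rewrite ler_nat.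
have n1 : 1 <= n by rewrite /n; lra.
have NE : N%:R = n + 1 by rewrite /n subrK.
have n0 : 0 < n by lra.
set H := \sum_i h i in hT *; set T := \sum_i \sum_j B i j in hT *.
pose Sd := \sum_i B i i.
pose Pp := \sum_i Bp i i; pose Pm := \sum_i Bm i i.
set Tp := \sum_i \sum_j Bp i j in Tp0; pose Tm := \sum_i \sum_j Bm i j.
have TE : T = Tp - Tm.
  by rewrite /T /Tp /Tm -sumrB; apply: eq_bigr => i _; rewrite -sumrB.
have SE : Sd = Pp - Pm by rewrite /Sd /Pp /Pm -sumrB.
have H0 : 0 <= H by apply: sumr_ge0.
have Pm0 : 0 <= Pm by apply: sumr_ge0.
have PpH : Pp <= 2 * k * H by rewrite mulr_sumr; apply: ler_sum.
(* Sum over all pairs of the positivity of W^- at (xi^i, xi^j). *)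
have TmP : Tm <= (n + 1) * Pm.
  have : 0 <= \sum_i \sum_j (Bm i i + Bm j j - 2 * Bm i j).
    by apply: sumr_ge0 => i _; apply: sumr_ge0.
  have -> : \sum_i \sum_j (Bm i i + Bm j j - 2 * Bm i j) = 2 * (N%:R * Pm - Tm).
    transitivity (\sum_i (N%:R * Bm i i + Pm - 2 * \sum_j Bm i j)).
      apply: eq_bigr => i _; rewrite sumrB big_split/= sumr_const card_ord -mulr_sumr.
      by rewrite mulr_natl.
    rewrite sumrB big_split/= -!mulr_sumr sumr_const card_ord -mulr_natl.
    by rewrite -/Pm -/Tm; ring.
  by rewrite pmulr_rge0// subr_ge0 NE.
have eS : delta * H + n^-1 * (T - Sd)
    - (1 - delta / 2) * (n^-1 ^+ 2 * ((n - 1) * T + Sd)) <= \sum_i e i.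
  apply: le_trans (ler_sum _ (fun i _ => he i)).
  rewrite sumrB big_split/= sumrB -/H -!mulr_sumr.
  have -> : \sum_(i < N) \sum_(j < N | j != i) h j = n * H.
    under eq_bigr do rewrite sum_neq.
    by rewrite sumrB sumr_const card_ord -/H -mulr_natl NE; ring.
  have -> : \sum_(i < N) \sum_(j < N | j != i) B j i = T - Sd.
    under eq_bigr do rewrite sum_neq.
    by rewrite sumrB exchange_big.
  have -> : \sum_(i < N) \sum_(j < N | j != i) n^-1 * (\sum_(k < N | k != i) B j k) =
      n^-1 * ((n - 1) * T + Sd).
    under eq_bigr do rewrite -mulr_sumr.
    by rewrite -mulr_sumr sum_sum_neq2 -/T -/Sd NE; congr (_ * _); ring.
  rewrite le_eqVlt; apply/orP; left; apply/eqP.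
  by field; rewrite gt_eqF.
rewrite sum_sum_neq -/T -/Sd.
set F := H + _ * _.
have q0 : 0 < n * delta - 1 - k by lra.
set q := _ - 1 - k in q0 *.
(* The diagonal costs at most k H and the hypothesis [hT] costs (1 - delta) (n + 1) H, leaving (n
   delta + delta - 1 - k) H; the term delta H is given up. *)
have FH : H * q <= n * F.
  have -> : n * F = n * H + (T - Sd) / 2 by rewrite /F; field; rewrite gt_eqF.
  have : 2^-1 * Sd <= k * H by lra.
  move: hT; rewrite NE /q; nra.
(* What exceeds delta F is a multiple of T - (n + 1) Sd. There Tp >= 0 and (n + 1) Pm - Tm >= 0, so
   only - (n + 1) Pp has to be paid for. *)
have {}eS : delta * F - (1 - delta / 2) * (n + 1) / n ^+ 2 * (2 * k * H) <= \sum_i e i.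
  apply: le_trans eS.
  have -> : delta * H + n^-1 * (T - Sd)
     - (1 - delta / 2) * (n^-1 ^+ 2 * ((n - 1) * T + Sd)) =
     delta * F + (1 - delta / 2) / n ^+ 2 * (T - (n + 1) * Sd).
    by rewrite /F; field; rewrite gt_eqF.
  have c0 : 0 <= (1 - delta / 2) / n ^+ 2 by rewrite divr_ge0 ?exprn_ge0//; lra.
  have -> : (1 - delta / 2) * (n + 1) / n ^+ 2 * (2 * k * H) =
      - ((1 - delta / 2) / n ^+ 2 * - ((n + 1) * (2 * k * H))) by ring.
  rewrite opprK lerD2l; apply: ler_wpM2l => //; rewrite TE SE; nra.
apply: le_trans eS; rewrite mulrBl lerD2l lerN2.
have F0 : 0 <= F by rewrite -(pmulr_rge0 _ n0); apply: le_trans FH; rewrite mulr_ge0// ltW.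
have HF : H <= n * F / q by rewrite ler_pdivlMr.
have c0 : 0 <= (1 - delta / 2) * (n + 1) / n ^+ 2 * (2 * k).
  by rewrite !mulr_ge0 ?invr_ge0 ?exprn_ge0//; lra.
apply: (@le_trans _ _ ((1 - delta / 2) * (n + 1) / n ^+ 2 * (2 * k) * (n * F / q))).
  by rewrite [leLHS]mulrA; exact: ler_wpM2l.
have -> : (1 - delta / 2) * (n + 1) / n ^+ 2 * (2 * k) * (n * F / q) =
    (2 - delta) * (k + k / n) * (F / q).
  by field; rewrite !gt_eqF.
have -> : 2 * (1 + k) / q * F = 2 * (1 + k) * (F / q) by ring.
apply: ler_wpM2r; first by rewrite divr_ge0// ltW.
(* Since 1 + k < n delta <= n; hence (2 - delta) (k + k / n) <= 2 (1 + k). *)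
have kn1 : k / n <= 1 by rewrite ler_pdivrMr// mul1r; nra.
have kn0 : 0 <= k / n by rewrite divr_ge0// ltW.
nra.
Qed.

End FinalAlgebra.

(** * Algebra of the reduced kernel *)

Section ReducedKernel.
Context (R : realType) (dim : nat) (S : ambient).
Local Notation X := 'rV[R]_dim.
Implicit Types (m mu nu : probability X R) (U W : X * X -> R).

Lemma qkernel_reduced m W : P2 S m -> qkernel S W -> qkernel S (reduced W m).
Proof.
move=> hm qW; have qf := qgrowth_Rintegral hm qW.
have qg := qgrowth_Rintegral hm (qkernel_swap qW).
exact: (qkernel_sub12 (bracket W m m) qW qf qg).
Qed.

Lemma reduced_symmetric m W : symmetric_kernel W -> symmetric_kernel (reduced W m).
Proof.
move=> sW x y; rewrite /reduced/= (sW x y).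
have E z : \int[m]_t W (t, z) = \int[m]_t W (z, t).
  by apply: eq_Rintegral => t _; rewrite sW.
by rewrite !E; ring.
Qed.

Lemma bracket_reduced_diff m mu W : P2 S m -> P2 S mu -> qkernel S W ->
  bracket (reduced W m) mu mu = bracket_diff W mu m.
Proof. by move=> hm hmu qW; rewrite (bracket_reduced hmu hmu hm qW). Qed.

(** Centring does not affect a difference of two probability measures, so positivity of W^- passes
    to the centred brackets of any pair xi^i, xi^j. *)
Lemma bracket_diff_reduced m mu nu W : P2 S m -> P2 S mu -> P2 S nu ->
  qkernel S W -> symmetric_kernel W ->
  bracket_diff W mu nu = bracket (reduced W m) mu mu + bracket (reduced W m) nu nu
    - 2 * bracket (reduced W m) mu nu.
Proof.
move=> hm hmu hnu qW sW; rewrite /bracket_diff !(@bracket_reduced _ _ S)//.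
rewrite (bracketC hnu hmu qW sW) (bracketC hm hmu qW sW) (bracketC hm hnu qW sW).
by ring.
Qed.

Lemma bracket_reducedB m mu nu W Wp Wm : P2 S m -> P2 S mu -> P2 S nu ->
  qkernel S Wp -> qkernel S Wm -> (forall p, W p = Wp p - Wm p) ->
  bracket (reduced W m) mu nu =
  bracket (reduced Wp m) mu nu - bracket (reduced Wm m) mu nu.
Proof.
move=> hm hmu hnu qp qm WE.
have WE' : W = (fun p => Wp p + -1 * Wm p) by apply/funext => p; rewrite WE mulN1r.
have qZ := qkernelZ (-1) qm; have qW := qkernelD qp qZ.
have E a b : P2 S a -> P2 S b -> bracket W a b = bracket Wp a b - bracket Wm a b.
  by move=> ha hb; rewrite WE' (bracketD ha hb qp qZ) (bracketZ (-1) ha hb qm) mulN1r.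
have qW' : qkernel S W by rewrite WE'.
by rewrite !(@bracket_reduced _ _ S)// !E//; ring.
Qed.

End ReducedKernel.

(** * From entropies to Fisher informations *)

Unset Implicit Arguments.

Theorem theorem9 (R : realType) (d : nat) (hd : (0 < d)%N) (S : ambient)
  (V : 'rV[R]_d -> R) (W : 'rV[R]_d * 'rV[R]_d -> R)
  (mstar : probability 'rV[R]_d R)
  (hV : lifted S V) (hV2 : Ck 2 V)
  (hW : is_kernel S W) (hW2 : Ck 2 W)
  (hWsym : symmetric_kernel W) (hWq : quadratic_growth S W)
  (hPi : normalizable S V W)
  (hmP2 : P2 S mstar)
  (hm : forall A : set 'rV[R]_d, measurable A -> mstar A = Pi_map S V W mstar A)
  (MW LW rho rhoPi delta : R)
  (hMW : 0 <= MW) (hLW : 0 <= LW)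
  (hrho : rhoPi <= rho) (hrhoPi : 0 < rhoPi)
  (hdelta0 : 0 < delta) (hdelta1 : delta <= 1)
  (hdec : decomposable S MW LW W)
  (hTal : Talagrand S rho mstar)
  (hLS : forall nu : probability 'rV[R]_d R, P2 S nu ->
    log_Sobolev S rhoPi (Pi_map S V W nu))
  (hF : forall nu : probability 'rV[R]_d R, P2 S nu ->
    (delta%:E * rel_entropy nu mstar <= free_energy W mstar nu)%E)
  (hHPi : forall nu : probability 'rV[R]_d R, P2 S nu ->
    (delta%:E * free_energy W mstar nu <= rel_entropy nu (Pi_map S V W nu))%E)
  (lW : R) (hlW : lW = LW / rho)
  (N : nat) (hN : delta^-1 * (1 + MW + lW) + 1 < N%:R)
  (lambdaN : R)
  (hlambdaN : lambdaN / rhoPi =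
    delta - 2 * (1 + MW + lW) / ((N%:R - 1) * delta - 1 - MW - lW))
  (xi : 'I_N -> probability 'rV[R]_d R) (hxi : forall i, P2 S (xi i)) :
  ((2 * lambdaN)%:E * free_energy_ind W mstar xi <=
   \sum_(i < N) Fisher S (xi i) (Pi_map S V W (others_mean xi i)))%E.
Proof.
have rho0 : 0 < rho by exact: lt_le_trans hrho.
have lW0 : 0 <= lW by rewrite hlW divr_ge0// ltW.
have qW : qkernel S W by split => //; case: hW.
have cV : continuous V by case: hV2.
pose k := MW + lW.
have k0 : 0 <= k by rewrite addr_ge0.
have nd : 1 + k < (N%:R - 1) * delta.
  by move: hN; rewrite -ltrBrDr -addrA mulrC ltr_pdivrMr.
have N1 : (1 < N)%N.
  rewrite -(ltr_nat R); have : 0 < (N%:R - 1) * delta by apply: lt_trans nd; rewrite ltr_wpDr.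
  by rewrite pmulr_lgt0// subr_gt0.
have n0 : 0 <= (N%:R - 1)^-1 :> R by rewrite invr_ge0 subr_ge0 ler1n ltnW.
pose nu i := mean_prob xi i.
have nuE i := mean_probE xi i N1.
have nuP2 i : P2 S (nu i) by exact: mixture_P2 n0 (nuE i) S hxi.
have LSI i : ((2 * rhoPi)%:E * rel_entropy (xi i) (Pi_map S V W (nu i)) <=
    Fisher S (xi i) (Pi_map S V W (others_mean xi i)))%E.
  by rewrite Pi_map_mean//; exact: hLS.
have /choice[kap kapE] := fun i => rel_entropy_Pi cV qW hPi hmP2 hm (nuP2 i).
have ent0 i : (0 <= rel_entropy (xi i) mstar)%E by exact: rel_entropy_ge0.
have Fisher_ge0 i : (0 <= Fisher S (xi i) (Pi_map S V W (others_mean xi i)))%E.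
  apply: le_trans (LSI i); rewrite mule_ge0 ?rel_entropy_ge0//.
  by rewrite lee_fin mulr_ge0// ltW.
(* If one entropy is infinite, so is H(xi^i | Pi[nu_i]), which differs from it by a finite amount;
   the log-Sobolev inequality then makes the right-hand side +oo. Otherwise everything but the
   Fisher informations is real. *)
have [[i entoo]|fin] := pselect (exists i, rel_entropy (xi i) mstar = +oo%E).
  suff -> : (\sum_(i < N) Fisher S (xi i) (Pi_map S V W (others_mean xi i)) = +oo)%E.
    exact: leey.
  have Foo : Fisher S (xi i) (Pi_map S V W (others_mean xi i)) = +oo%E.
    apply/eqP; rewrite -leye_eq; apply: le_trans (LSI i).
    by rewrite kapE// entoo addye// gt0_muley// lte_fin mulr_gt0.
  rewrite (bigD1 i)//= Foo addye// gt_eqF// (@lt_le_trans _ _ 0%E)//.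
  by apply: sume_ge0.
have {}fin i : rel_entropy (xi i) mstar \is a fin_num.
  rewrite ge0_fin_numE// ltey; apply/eqP => oo; apply: fin; by exists i.
pose h i := fine (rel_entropy (xi i) mstar).
have hE i : rel_entropy (xi i) mstar = (h i)%:E by rewrite fineK.
have h0 i : 0 <= h i by rewrite fine_ge0.
pose br U i j := bracket (reduced U mstar) (xi i) (xi j).
have [Wp [Wm [WE [qp sp pp] [qm sm pm] WpH]]] :=
  decomposable_split hdec hMW hLW rho0 hmP2 hTal.
have BE i j : br W i j = br Wp i j - br Wm i j.
  exact: (bracket_reducedB hmP2 (hxi i) (hxi j) qp qm WE).
have qR := qkernel_reduced hmP2 qW; have sR := reduced_symmetric mstar hWsym.
(* The mean of all the xi^i, as the mean over the nonzero indices of 'I_N.+1. *)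
pose xi' (l : 'I_N.+1) := if unlift ord0 l is Some j then xi j else mstar.
pose bar := mean_prob xi' ord0.
have barE A : measurable A ->
    (bar A = (N%:R^-1)%:E * \sum_(j < N | xpredT j) xi j A)%E.
  move=> mA; rewrite mean_probE; [|exact: ltnW|exact: mA].
  rewrite -natr1 addrK; congr (_ * _)%E.
  rewrite big_mkcond big_ord_recl/= add0e; apply: eq_bigr => j _.
  by rewrite /xi' liftK.
have Ni0 : 0 <= N%:R^-1 :> R by rewrite invr_ge0.
have NN0 : N%:R != 0 :> R by rewrite pnatr_eq0 -lt0n ltnW.
have barP2 : P2 S bar by exact: mixture_P2 Ni0 barE S hxi.
have bar_br U : qkernel S U -> symmetric_kernel U ->
    bracket (reduced U mstar) bar bar = N%:R^-1 * (N%:R^-1 * \sum_i \sum_j br U i j).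
  move=> qU sU; have qU' := qkernel_reduced hmP2 qU; have sU' := reduced_symmetric mstar sU.
  rewrite (bracket_mixture Ni0 barE hxi barP2 qU'); congr (_ * _).
  rewrite mulr_sumr; apply: eq_bigr => i _.
  rewrite (bracketC (hxi i) barP2 qU' sU') (bracket_mixture Ni0 barE hxi (hxi i) qU').
  by congr (_ * _); apply: eq_bigr => j _; rewrite (bracketC (hxi j) (hxi i) qU' sU').
have entmean (P : pred 'I_N) c (mu : probability _ R) : 0 <= c ->
    (forall A, measurable A -> mu A = c%:E * \sum_(j < N | P j) xi j A)%E ->
    exists2 hmu, rel_entropy mu mstar = hmu%:E & hmu <= c * \sum_(j < N | P j) h j.
  move=> c0 muE; have := rel_entropy_mean (m := mstar) c0 muE.
  under eq_bigr do rewrite hE.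
  rewrite sumEFin -EFinM => le; have := rel_entropy_ge0 mu mstar.
  have {le} : (rel_entropy mu mstar <= (c * \sum_(j < N | P j) h j)%:E)%E.
    by apply: le => j; rewrite hE ltry.
  case: (rel_entropy mu mstar) => // r; rewrite lee_fin => rle _.
  by exists r.
pose e i := h i + (kap i + bracket W (xi i) (nu i) - bracket W (xi i) mstar).
have eE i : rel_entropy (xi i) (Pi_map S V W (nu i)) = (e i)%:E.
  by rewrite kapE// hE.
have main : (delta - 2 * (1 + k) / ((N%:R - 1) * delta - 1 - k)) *
    (\sum_i h i + (2 * (N%:R - 1))^-1 * \sum_i \sum_(j < N | i != j) br W i j) <= \sum_i e i.
  have BB : br W = fun i j => br Wp i j - br Wm i j.
    by apply/funext => i; apply/funext => j.
  rewrite BB; apply: (entropy_sum_lower_bound (h := h)) => //.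
  - move=> i; rewrite /br (bracket_reduced_diff hmP2 (hxi i) qp) /k hlW.
    by apply: WpH => //; exact: hE.
  (* The full double sum of b^+ is N^2 b^+(bar, bar), which is nonnegative by positivity of W^+ at
     the pair (bar, m). *)
  - have := pp _ _ barP2 hmP2; rewrite -(bracket_reduced_diff hmP2 barP2 qp) (bar_br Wp)//.
    by rewrite !pmulr_rge0// invr_gt0 lt0r NN0/=.
  - by move=> i; rewrite /br (bracket_reduced_diff hmP2 (hxi i) qm); exact: pm.
  - by move=> i j; rewrite -(bracket_diff_reduced hmP2 (hxi i) (hxi j) qm sm); exact: pm.
  (* F >= delta H at [bar] reads T / (2 N^2) >= - (1 - delta) H(bar | m). Multiply by N^2 and use N
     H(bar | m) <= sum_i H(xi^i | m), where delta <= 1 fixes the direction. *)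
  - have [hb hbE hbH] := entmean xpredT _ bar Ni0 barE.
    have := hF _ barP2; rewrite /free_energy hbE (bar_br W)// -EFinM -EFinD lee_fin.
    rewrite BB; set T := \sum_i _; set H := \sum_i _ in hbH * => bF.
    have N0 : 0 < N%:R :> R by rewrite lt0r NN0 ler0n.
    have -> : 2^-1 * T = N%:R * N%:R * (1 / 2 * (N%:R^-1 * (N%:R^-1 * T))).
      by field; rewrite NN0.
    have hbN : N%:R * hb <= H by rewrite mulrC -ler_pdivlMr// mulrC.
    have : - ((1 - delta) * hb) <= 1 / 2 * (N%:R^-1 * (N%:R^-1 * T)) by lra.
    move/(ler_wpM2l (mulr_ge0 (ltW N0) (ltW N0))); apply: le_trans.
    have : (1 - delta) * N%:R * (N%:R * hb) <= (1 - delta) * N%:R * H.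
      by apply: ler_wpM2l => //; rewrite mulr_ge0// subr_ge0.
    lra.
  (* [Hi] bounds [kap i] from below. Substituted in [e i], it leaves uncentred brackets that
     regroup, by symmetry of W, into b(nu_i, xi^i) - (1 - delta / 2) b(nu_i, nu_i). *)
  - move=> i; have [hn hnE hnH] := entmean _ _ (nu i) n0 (nuE i).
    have := hHPi _ (nuP2 i); rewrite kapE// /free_energy hnE -!EFinD -EFinM lee_fin => Hi.
    have D1 : bracket (reduced W mstar) (nu i) (nu i) = (N%:R - 1)^-1 *
        \sum_(j < N | j != i) ((N%:R - 1)^-1 * \sum_(l < N | l != i) br W j l).
      rewrite (bracket_mixture n0 (nuE i) hxi (nuP2 i) qR); congr (_ * _).
      apply: eq_bigr => j _.
      rewrite (bracketC (hxi j) (nuP2 i) qR sR) (bracket_mixture n0 (nuE i) hxi (hxi j) qR).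
      by congr (_ * _); apply: eq_bigr => l _; rewrite (bracketC (hxi l) (hxi j) qR sR).
    have D2 : bracket (reduced W mstar) (nu i) (xi i) = (N%:R - 1)^-1 *
        \sum_(j < N | j != i) br W j i.
      by rewrite (bracket_mixture n0 (nuE i) hxi (hxi i) qR).
    move: D1 D2; rewrite BB => <- <-; move: Hi; rewrite /e !(@bracket_reduced _ _ S)//.
    rewrite (bracketC (nuP2 i) (hxi i) qW hWsym).
    rewrite (bracketC hmP2 (hxi i) qW hWsym) (bracketC hmP2 (nuP2 i) qW hWsym).
    nra.
have ind : free_energy_ind W mstar xi =
    (\sum_i h i + (2 * (N%:R - 1))^-1 * \sum_i \sum_(j < N | i != j) br W i j)%:E.
  by rewrite /free_energy_ind; under eq_bigr do rewrite hE; rewrite sumEFin.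
apply: (@le_trans _ _ (\sum_(i < N) ((2 * rhoPi)%:E * (e i)%:E))%E); last first.
  by apply: lee_sum => i _; rewrite -eE.
rewrite -ge0_sume_distrr; last first.
  by move=> i _; rewrite -eE; exact: rel_entropy_ge0.
rewrite sumEFin ind -!EFinM lee_fin.
(* Only the positive factor 2 [rhoPi] is multiplied through, so the sign of [lambdaN] does not
   matter. *)
have -> : lambdaN = rhoPi * (lambdaN / rhoPi) by rewrite mulrC divfK// gt_eqF.
rewrite hlambdaN [2 * (rhoPi * _)]mulrA -[leLHS]mulrA.
apply: ler_wpM2l; first by rewrite mulr_ge0// ltW.
by move: main; rewrite /k opprD !addrA.
Qed.
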